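(* Let $\beta>1$ and let $\psi:[0,1]\to\mathbb{R}$ be continuous. Let $a<b$ be real numbers such that $[a,b]\cap\mathfrak{L}_{\psi}\neq\emptyset$. Then $$\dim_H\{x\in[0,1):\mathsf{A}(\psi,x)\subset[a,b]\}=\sup\{h_{\beta}(\alpha):\alpha\in[a,b]\cap\mathfrak{L}_{\psi}\}.$$
   Context: $T_\beta:[0,1)\to[0,1)$ is the $\beta$-transformation $T_\beta(x)=\beta x-\lfloor\beta x\rfloor$. For $x\in[0,1)$ and $n\ge1$, $S_n\psi(x)=\sum_{j=0}^{n-1}\psi(T_\beta^j x)$. $\mathsf{A}(\psi,x)$ denotes the set of accumulation points of the sequence $\{\frac1n S_n\psi(x)\}_{n\ge1}$. $\mathfrak{L}_\psi=\bigcup_{x\in[0,1)}\mathsf{A}(\psi,x)$ (a closed interval; equivalently the set of $\int\psi\,d\mu$ over $T_\beta$-invariant probability measures $\mu$). For $\alpha\in\mathfrak{L}_\psi$, $E_\alpha=\{x\in[0,1):\lim_{n\to\infty}\frac1nS_n\psi(x)=\alpha\}$ and $h_\beta(\alpha)=\dim_H E_\alpha$; equivalently $h_\beta(\alpha)=\sup\{h_\mu/\log\beta:\mu \text{ a } T_\beta\text{-invariant probability measure with }\int\psi\,d\mu=\alpha\}$, where $h_\mu$ is the measure-theoretic entropy. $\dim_H$ denotes Hausdorff dimension. *)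

(* Defs.v *)
From Stdlib Require Import Reals Lra ClassicalEpsilon.
Open Scope R_scope.

Definition Tbeta (beta x : R) : R := beta * x - IZR (Int_part (beta * x)).

Fixpoint Birk (beta : R) (psi : R -> R) (n : nat) (x : R) : R :=
  match n with
  | O => 0
  | S m => Birk beta psi m x + psi (Nat.iter m (Tbeta beta) x)
  end.

(* the sequence (1/n) S_n psi x, n >= 1, reindexed by k = n - 1 *)
Definition birk_avg (beta : R) (psi : R -> R) (x : R) (k : nat) : R :=
  Birk beta psi (S k) x / INR (S k).

Definition acc_pt (beta : R) (psi : R -> R) (x c : R) : Prop :=
  forall eps, eps > 0 -> forall N : nat, exists k : nat,
    (N <= k)%nat /\ Rabs (birk_avg beta psi x k - c) < eps.

Definition Lpsi (beta : R) (psi : R -> R) (c : R) : Prop :=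
  exists x, 0 <= x < 1 /\ acc_pt beta psi x c.

Definition Ealpha (beta : R) (psi : R -> R) (alpha : R) (x : R) : Prop :=
  0 <= x < 1 /\ Un_cv (birk_avg beta psi x) alpha.

(* s-dimensional Hausdorff measure of E is zero (s > 0): for every eps>0 there
   is a countable cover by nondegenerate intervals [a_i,b_i] with
   sum (b_i - a_i)^s <= eps. *)
Definition Hnull (s : R) (E : R -> Prop) : Prop :=
  forall eps, eps > 0 ->
  exists (l r : nat -> R),
    (forall i, l i < r i) /\
    (forall x, E x -> exists i, l i <= x <= r i) /\
    (forall N, sum_f_R0 (fun i => Rpower (r i - l i) s) N <= eps).

Definition is_glb (S : R -> Prop) (m : R) : Prop :=
  (forall s, S s -> m <= s) /\
  (forall m', (forall s, S s -> m' <= s) -> m' <= m).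

Definition dimH (E : R -> Prop) : R :=
  epsilon (inhabits 0) (fun d => is_glb (fun s => s > 0 /\ Hnull s E) d).

Definition hbeta (beta : R) (psi : R -> R) (alpha : R) : R :=
  dimH (Ealpha beta psi alpha).

Definition cont_on_01 (psi : R -> R) : Prop :=
  forall x, 0 <= x <= 1 -> forall eps, eps > 0 -> exists del, del > 0 /\
    forall y, 0 <= y <= 1 -> Rabs (y - x) < del -> Rabs (psi y - psi x) < eps.

(* Main.v *)
(* Upper bound: if x lies in the set on the left, then for all large n the rank-n
   cylinder of x has Birkhoff average close to [a,b]. Call alpha rich at rate sigma if,
   for every neighbourhood of alpha and arbitrarily large n, more than beta^(sigma n)
   cylinders of rank n have their average in it. If no alpha in [a,b] is rich at rate
   sigma, compactness of [a,b] bounds the number of relevant cylinders by a multiple of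
   beta^(sigma n), so the set has dimension at most sigma. Lower bound: if alpha is rich
   at rate sigma, then lowering the last nonzero digit turns the words counted at rank n
   into full words, at most n+2 to one and with Birkhoff sums changed by o(n). Full words
   concatenate freely, and concatenating them slowly enough gives a Moran set inside
   E_alpha of dimension at least sigma. *)
Require Import Defs.
From Stdlib Require Import Reals Lra Lia List ZArith Classical ClassicalEpsilon.
Import ListNotations.
Open Scope R_scope.

(** * Continuity on the unit interval *)

(** The obstacle is that [T^n] may map the cylinder of an admissible word onto a proper part of
    [0,1), and then the word cannot be followed freely. After the lowering, the new cylinder ends
    exactly at the old point, which is below 1, so nothing is cut off. A word is represented
    throughout by the left endpoint [p] of its cylinder, so that counting words means counting reals
    with [T^n p = 0]. Richness asks for many words only at arbitrarily large lengths, hence its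
    negation bounds the counts at all large lengths, which is the form a covering argument can use.
    Conversely, one good length per precision suffices for the lower bound: a block is repeated
    until the next one is short compared with what precedes it. The Moran set so obtained is
    nonempty, which is also how [alpha] is seen to be an attained limit. Gaps between exponents pay
    for every loss: the multiplicity of the lowering, and the delay of one generation when an
    interval is compared with cylinders. *)

Definition bounded_on_01 (psi : R -> R) (B : R) : Prop :=
  forall x, 0 <= x <= 1 -> Rabs (psi x) <= B.

(** The retraction of the line onto [0,1] is 1-Lipschitz. Composing with it turns relative
    continuity into two-sided continuity at the endpoints too, as Heine's theorem and the extreme
    value theorem are stated. *)
Lemma clamp_continuity (psi : R -> R) :
  cont_on_01 psi -> continuity (fun x => psi (Rmax 0 (Rmin 1 x))).
Proof.
  intros H x eps Heps.
  assert (Hc : forall z, 0 <= Rmax 0 (Rmin 1 z) <= 1).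
  { intros z. unfold Rmax, Rmin. repeat destruct Rle_dec; lra. }
  destruct (H _ (Hc x) eps Heps) as (del & Hdel & Hd).
  exists del; split; [exact Hdel|].
  intros y [_ Hy]. simpl in *. unfold Rdist in *. apply Hd; [apply Hc|].
  eapply Rle_lt_trans; [|exact Hy].
  unfold Rmax, Rmin. repeat destruct Rle_dec; split_Rabs; lra.
Qed.

Lemma clamp_id x : 0 <= x <= 1 -> Rmax 0 (Rmin 1 x) = x.
Proof. intros; unfold Rmax, Rmin; repeat destruct Rle_dec; lra. Qed.

Lemma cont_on_01_uniform (psi : R -> R) :
  cont_on_01 psi -> forall eps, eps > 0 -> exists del, del > 0 /\
    forall x y, 0 <= x <= 1 -> 0 <= y <= 1 -> Rabs (x - y) < del ->
      Rabs (psi x - psi y) < eps.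
Proof.
  intros H eps Heps. pose proof (clamp_continuity psi H) as Hc.
  destruct (Heine_cor2 (a := 0) (b := 1) (fun x _ => Hc x) (mkposreal eps Heps)) as [d Hd].
  exists d; split; [apply cond_pos|]. intros x y Hx Hy Hxy.
  specialize (Hd x y Hx Hy Hxy). simpl in Hd.
  rewrite !clamp_id in Hd by assumption. exact Hd.
Qed.

Lemma cont_on_01_bounded (psi : R -> R) :
  cont_on_01 psi -> exists B, 0 <= B /\ bounded_on_01 psi B.
Proof.
  intros H. pose proof (clamp_continuity psi H) as Hc.
  assert (Ha : continuity (fun x => Rabs (psi (Rmax 0 (Rmin 1 x))))).
  { intros x. apply (continuity_pt_comp (fun x => psi (Rmax 0 (Rmin 1 x))) Rabs).
    apply Hc. apply Rcontinuity_abs. }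
  destruct (continuity_ab_maj _ 0 1 ltac:(lra) (fun x _ => Ha x)) as (M & HM & _).
  exists (Rabs (psi (Rmax 0 (Rmin 1 M)))). split; [apply Rabs_pos|].
  intros x Hx. specialize (HM x Hx). rewrite clamp_id in HM by assumption. exact HM.
Qed.

(** * Hausdorff null sets *)

Definition cover_sum (s : R) (l : list (R * R)) : R :=
  fold_right (fun p acc => Rpower (snd p - fst p) s + acc) 0 l.

Lemma Rpower_pos x y : 0 < Rpower x y.
Proof. apply exp_pos. Qed.

Lemma cover_sum_nonneg s l : 0 <= cover_sum s l.
Proof.
  induction l as [|p l IH]; simpl; [lra|]. pose proof (Rpower_pos (snd p - fst p) s). lra.
Qed.

Lemma cover_sum_app s l l' : cover_sum s (l ++ l') = cover_sum s l + cover_sum s l'.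
Proof. induction l as [|p l IH]; simpl; [|rewrite IH]; lra. Qed.

Lemma cover_sum_nth s l d N : (N < length l)%nat ->
  sum_f_R0 (fun i => Rpower (snd (nth i l d) - fst (nth i l d)) s) N <= cover_sum s l.
Proof.
  revert N; induction l as [|p l IH]; simpl; intros N HN; [lia|].
  destruct N as [|N].
  - simpl. pose proof (cover_sum_nonneg s l). lra.
  - rewrite decomp_sum by lia. simpl. specialize (IH N ltac:(lia)). lra.
Qed.

Fixpoint prefix_blocks (B : nat -> list (R * R)) (m : nat) : list (R * R) :=
  match m with O => [] | S k => prefix_blocks B k ++ B k end.

Lemma prefix_blocks_nth B m m' i d :
  (i < length (prefix_blocks B m))%nat -> (i < length (prefix_blocks B m'))%nat ->
  nth i (prefix_blocks B m) d = nth i (prefix_blocks B m') d.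
Proof.
  assert (W : forall m k, (i < length (prefix_blocks B m))%nat ->
    nth i (prefix_blocks B (k + m)) d = nth i (prefix_blocks B m) d /\
    (i < length (prefix_blocks B (k + m)))%nat).
  { intros p k Hi. induction k; simpl; [auto|]. rewrite length_app. destruct IHk as [E L].
    rewrite app_nth1 by exact L. split; [exact E|lia]. }
  intros H H'. destruct (Nat.le_ge_cases m m').
  - replace m' with ((m' - m) + m)%nat by lia. symmetry; now apply W.
  - replace m with ((m - m') + m')%nat by lia. now apply W.
Qed.

(* Concatenating the m-th cover at total cost eps/2^(m+1) gives a single countable
   cover; the padding interval (0, tiny m) keeps every block nonempty, so that the
   concatenation is indexed by all of nat. *)
Lemma Hnull_countable_union (s : R) (E : nat -> R -> Prop) : 0 < s ->
  (forall m eps, eps > 0 -> exists (Q : list R) (rho : R), 0 < rho /\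
     INR (length Q) * Rpower rho s <= eps /\
     (forall x, E m x -> exists q, In q Q /\ q <= x <= q + rho)) ->
  Hnull s (fun x => exists m, E m x).
Proof.
  intros Hs H eps Heps.
  assert (He : forall m, eps / 2 ^ (m + 2) > 0).
  { intros m. apply Rdiv_lt_0_compat; [lra|apply pow_lt; lra]. }
  assert (H' : exists (Q : nat -> list R) (rho : nat -> R), forall m, 0 < rho m /\
     INR (length (Q m)) * Rpower (rho m) s <= eps / 2 ^ (m + 2) /\
     (forall x, E m x -> exists q, In q (Q m) /\ q <= x <= q + rho m)).
  { pose (f := fun m => constructive_indefinite_description _ (H m _ (He m))).
    pose (g := fun m => constructive_indefinite_description _ (proj2_sig (f m))).
    exists (fun m => proj1_sig (f m)), (fun m => proj1_sig (g m)).
    intros m. exact (proj2_sig (g m)). }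
  destruct H' as (Q & rho & HQ).
  (* Its s-th power is exactly [eps / 2 ^ (m + 2)], the half of the budget of block m that the cover
     itself leaves. *)
  pose (tiny := fun m => Rpower (eps / 2 ^ (m + 2)) (/ s)).
  pose (B := fun m => (0, tiny m) :: map (fun q => (q, q + rho m)) (Q m)).
  assert (HBlt : forall m p, In p (B m) -> fst p < snd p).
  { intros m p [<-|Hp]; simpl.
    - apply Rpower_pos.
    - apply in_map_iff in Hp. destruct Hp as (q & <- & _). simpl.
      destruct (HQ m). lra. }
  assert (HBsum : forall m, cover_sum s (B m) <= eps / 2 ^ (m + 1)).
  { intros m. unfold B. simpl. rewrite Rminus_0_r. unfold tiny.
    rewrite Rpower_mult, Rinv_l, Rpower_1 by (lra || apply He).
    assert (E1 : cover_sum s (map (fun q => (q, q + rho m)) (Q m)) =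
                 INR (length (Q m)) * Rpower (rho m) s).
    { generalize (Q m); intros l. induction l as [|q l IH]; [simpl; lra|].
      cbn [map cover_sum fold_right length fst snd] in *. fold (cover_sum s) in *.
      unfold cover_sum in IH. rewrite IH, S_INR.
      replace (q + rho m - q) with (rho m) by lra. lra. }
    rewrite E1. destruct (HQ m) as (_ & Hq & _).
    replace (eps / 2 ^ (m + 1)) with (eps / 2 ^ (m + 2) + eps / 2 ^ (m + 2)); [lra|].
    rewrite !pow_add. simpl. field. apply pow_nonzero; lra. }
  assert (Hlen : forall m, (m <= length (prefix_blocks B m))%nat).
  { induction m; simpl; [lia|]. rewrite length_app. simpl. lia. }
  assert (Hin : forall m p, In p (prefix_blocks B m) -> fst p < snd p).
  { induction m; simpl; intros p Hp; [contradiction|]. apply in_app_iff in Hp.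
    destruct Hp; eauto. }
  assert (Hsum : forall m, cover_sum s (prefix_blocks B m) <= eps * (1 - / 2 ^ m)).
  { induction m; [simpl; lra|].
    change (prefix_blocks B (S m)) with (prefix_blocks B m ++ B m).
    rewrite cover_sum_app. specialize (HBsum m).
    replace (eps * (1 - / 2 ^ S m)) with (eps * (1 - / 2 ^ m) + eps / 2 ^ (m + 1)); [lra|].
    rewrite pow_add. simpl. field. apply pow_nonzero; lra. }
  (* Every block is nonempty, so the first [S i] blocks have an entry of index i and the default
     [(0, 1)] is never reached. *)
  pose (sq := fun i => nth i (prefix_blocks B (S i)) (0, 1)).
  exists (fun i => fst (sq i)), (fun i => snd (sq i)). split; [|split].
  - intros i. apply (Hin (S i)). apply nth_In. apply Hlen.
  - intros x (m & Hx). destruct (HQ m) as (_ & _ & Hc).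
    destruct (Hc x Hx) as (q & Hq & Hqx).
    assert (Hp : In (q, q + rho m) (prefix_blocks B (S m))).
    { simpl. apply in_app_iff. right. right. apply in_map_iff. exists q; auto. }
    destruct (In_nth _ _ (0, 1) Hp) as (i & Hi & Ei). exists i. unfold sq.
    rewrite (prefix_blocks_nth B (S i) (S m)) by (exact Hi || apply Hlen).
    rewrite Ei. exact Hqx.
  - intros N.
    rewrite (sum_eq _ (fun i => Rpower (snd (nth i (prefix_blocks B (S N)) (0, 1)) -
                                    fst (nth i (prefix_blocks B (S N)) (0, 1))) s)).
    + eapply Rle_trans; [apply cover_sum_nth; apply Hlen|].
      eapply Rle_trans; [apply Hsum|]. rewrite <- (Rmult_1_r eps) at 2.
      apply Rmult_le_compat_l; [lra|].
      pose proof (Rinv_0_lt_compat (2 ^ S N) (pow_lt 2 (S N) ltac:(lra))). lra.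
    + intros i Hi. unfold sq.
      rewrite (prefix_blocks_nth B (S i) (S N)); [reflexivity|apply Hlen|].
      pose proof (Hlen (S N)). lia.
Qed.

Lemma Hnull_subset s (E F : R -> Prop) :
  (forall x, E x -> F x) -> Hnull s F -> Hnull s E.
Proof.
  intros H HF eps He. destruct (HF eps He) as (l & r & H1 & H2 & H3).
  exists l, r. auto.
Qed.

Lemma Hnull_empty s (E : R -> Prop) : 0 < s -> (forall x, ~ E x) -> Hnull s E.
Proof.
  intros Hs HE. apply Hnull_subset with (fun x => exists m : nat, (fun _ => E) m x).
  - intros x Hx. exists 0%nat. exact Hx.
  - apply Hnull_countable_union; [exact Hs|]. intros m eps He.
    exists [], 1. split; [lra|]. split; [simpl; lra|]. intros x Hx. elim (HE x Hx).
Qed.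

(** * Counting in lists *)

Lemma flat_map_flat_map {A B C} (f : B -> list C) (g : A -> list B) l :
  flat_map f (flat_map g l) = flat_map (fun a => flat_map f (g a)) l.
Proof. induction l; simpl; [reflexivity|]. now rewrite flat_map_app, IHl. Qed.

Lemma NoDup_flat_map_disjoint {A B} (f : A -> list B) l :
  NoDup l -> (forall a, In a l -> NoDup (f a)) ->
  (forall a a' w, In a l -> In a' l -> a <> a' -> In w (f a) -> In w (f a') -> False) ->
  NoDup (flat_map f l).
Proof.
  induction l as [|a l IH]; intros Hl Hf Hd; simpl; [constructor|].
  inversion_clear Hl. apply NoDup_app.
  - apply Hf; left; reflexivity.
  - apply IH; [assumption| |]; intros; [apply Hf; right; assumption|].
    apply (Hd a0 a' w); simpl; auto.
  - intros w Hw Hw'. apply in_flat_map in Hw'. destruct Hw' as (a' & Ha' & Hw').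
    apply (Hd a a' w); simpl; auto. intros ->; contradiction.
Qed.

(** Meant for a tree: [l] is a generation and [g u] are the later descendants of [u]. A counted
    descendant forces its ancestor to pass the coarser test [h]. *)
Lemma length_filter_flat_map_le {A B} (f : B -> bool) (h : A -> bool) (g : A -> list B) c l :
  (forall u, In u l -> length (g u) = c) ->
  (forall u w, In u l -> In w (g u) -> f w = true -> h u = true) ->
  (length (filter f (flat_map g l)) <= length (filter h l) * c)%nat.
Proof.
  induction l as [|u l IH]; intros Hc Hh; simpl; [lia|].
  rewrite filter_app, length_app.
  specialize (IH (fun v Hv => Hc v (or_intror Hv))
                 (fun v w Hv => Hh v w (or_intror Hv))).
  destruct (h u) eqn:E.
  - simpl. pose proof (filter_length_le f (g u)).
    rewrite Hc in H by (left; reflexivity). lia.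
  - assert (filter f (g u) = []) as ->; [|simpl; lia].
    destruct (filter f (g u)) as [|w k] eqn:Ef; [reflexivity|].
    assert (Hw : In w (filter f (g u))) by (rewrite Ef; left; reflexivity).
    apply filter_In in Hw. destruct Hw as [Hw1 Hw2].
    rewrite (Hh u w) in E; [discriminate|left; reflexivity|assumption|assumption].
Qed.

Lemma length_filter_filter_le {A} (f g : A -> bool) l :
  (length (filter f (filter g l)) <= length (filter f l))%nat.
Proof.
  induction l as [|a l IH]; simpl; [lia|].
  destruct (g a); simpl; destruct (f a); simpl; lia.
Qed.

(** Union bound. The induction removes what the last test catches; the rest must be caught by an
    earlier one. *)
Lemma length_le_sum_filter {A} (f : nat -> A -> bool) K l :
  (forall w, In w l -> exists k, (k <= K)%nat /\ f k w = true) ->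
  INR (length l) <= sum_f_R0 (fun k => INR (length (filter (f k) l))) K.
Proof.
  revert l; induction K; intros l H.
  - simpl. apply le_INR. apply Nat.eq_le_incl. f_equal. symmetry.
    induction l as [|a l IH]; [reflexivity|]. simpl.
    destruct (H a (or_introl eq_refl)) as (k & Hk & E).
    replace k with 0%nat in E by lia. rewrite E. f_equal. apply IH.
    intros w Hw. apply H. right; exact Hw.
  - simpl. rewrite <- (filter_length (f (S K)) l), plus_INR, Rplus_comm.
    apply Rplus_le_compat_r.
    eapply Rle_trans; [apply IHK|].
    + intros w Hw. apply filter_In in Hw. destruct Hw as [Hw1 Hw2].
      destruct (H w Hw1) as (k & Hk & E). exists k. split; [|exact E].
      destruct (Nat.eq_dec k (S K)) as [->|]; [rewrite E in Hw2; discriminate|lia].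
    + apply sum_Rle. intros k Hk. apply le_INR, length_filter_filter_le.
Qed.

(** The middle point is at least [rho] from both others, so the outer two are at least [2 * rho]
    apart. *)
Lemma three_separated (rho lo hi x y z : R) :
  hi - lo < 2 * rho -> lo < x < hi -> lo < y < hi -> lo < z < hi ->
  rho <= Rabs (x - y) -> rho <= Rabs (x - z) -> rho <= Rabs (y - z) -> False.
Proof. intros. split_Rabs; lra. Qed.

(** * Cylinders of the beta-transformation *)

Section Dynamics.

Variable b : R.
Hypothesis Hb : 1 < b.

Notation T := (Tbeta b).
Notation Tn n x := (Nat.iter n (Tbeta b) x).

Lemma pow_b_pos n : 0 < b ^ n.
Proof. apply pow_lt; lra. Qed.

Lemma inv_pow_pos n : 0 < / b ^ n.
Proof. apply Rinv_0_lt_compat, pow_b_pos. Qed.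

Lemma inv_pow_le1 n : / b ^ n <= 1.
Proof.
  rewrite <- Rinv_1. apply Rinv_le_contravar; [lra|]. apply pow_R1_Rle; lra.
Qed.

Lemma inv_pow_antitone n m : (n <= m)%nat -> / b ^ m <= / b ^ n.
Proof.
  intros. apply Rinv_le_contravar; [apply pow_b_pos|]. apply Rle_pow; [lra|lia].
Qed.

Lemma inv_pow_small eta : 0 < eta -> exists k0, forall k, (k0 <= k)%nat -> / b ^ k < eta.
Proof.
  intros He.
  destruct (pow_lt_1_zero (/ b)) with (y := eta) as [N HN].
  - rewrite Rabs_pos_eq. rewrite <- Rinv_1. apply Rinv_lt_contravar; lra.
    left; apply Rinv_0_lt_compat; lra.
  - exact He.
  - exists N. intros k Hk. specialize (HN k Hk).
    rewrite pow_inv in HN. rewrite Rabs_pos_eq in HN; [exact HN|].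
    left; apply inv_pow_pos.
Qed.

Lemma T_char (k : Z) z r : b * z = IZR k + r -> 0 <= r < 1 -> T z = r.
Proof.
  intros H Hr. unfold Tbeta.
  rewrite <- (Int_part_spec (b * z) k) by lra. lra.
Qed.

Lemma T_range x : 0 <= T x < 1.
Proof. unfold Tbeta. destruct (base_Int_part (b * x)). lra. Qed.

Lemma T_digit x : 0 <= x -> exists d : Z, (0 <= d)%Z /\ b * x = IZR d + T x.
Proof.
  intros Hx. exists (Int_part (b * x)). split; [|unfold Tbeta; lra].
  destruct (base_Int_part (b * x)).
  assert (-1 < Int_part (b * x))%Z; [|lia].
  apply lt_IZR. assert (0 <= b * x) by (apply Rmult_le_pos; lra). lra.
Qed.

Lemma Tn_range n x : 0 <= x < 1 -> 0 <= Tn n x < 1.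
Proof. intros H; destruct n; [exact H|apply T_range]. Qed.

Lemma Tn_shift n x : Tn (S n) x = Tn n (T x).
Proof. apply Nat.iter_succ_r. Qed.

Lemma Tn_add n m x : Tn (n + m) x = Tn n (Tn m x).
Proof. apply Nat.iter_add. Qed.

Lemma T_0 : T 0 = 0.
Proof. apply (T_char 0); lra. Qed.

Lemma Tn_0 n : Tn n 0 = 0.
Proof. induction n; [reflexivity|]. simpl. rewrite IHn. apply T_0. Qed.

(* Left endpoint of the rank-n cylinder of x. *)
Definition lft (n : nat) (x : R) : R := x - Tn n x / b ^ n.

(** Truncating the expansion after n+1 digits and truncating that of [T x] after n digits differ
    only by the first digit [d]. *)
Lemma lft_step n x d :
  b * x = IZR d + T x -> b * lft (S n) x = IZR d + lft n (T x).
Proof.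
  intros Hd. unfold lft. rewrite Tn_shift. rewrite Rmult_minus_distr_l, Hd.
  simpl. pose proof (pow_b_pos n). field; lra.
Qed.

Lemma lft_bounds n x : 0 <= x < 1 -> 0 <= lft n x <= x.
Proof.
  revert x; induction n; intros x Hx.
  - unfold lft; simpl. lra.
  - destruct (T_digit x) as (d & Hd0 & Hd); [lra|].
    pose proof (lft_step n x d Hd) as E. pose proof (IHn (T x) (T_range x)).
    apply IZR_le in Hd0. split.
    + apply Rmult_le_reg_l with b; lra.
    + apply Rmult_le_reg_l with b; lra.
Qed.

Lemma T_lft n x : 0 <= x < 1 -> T (lft (S n) x) = lft n (T x).
Proof.
  intros Hx. destruct (T_digit x) as (d & Hd0 & Hd); [lra|].
  apply (T_char d); [apply lft_step; exact Hd|].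
  pose proof (lft_bounds n (T x) (T_range x)). pose proof (T_range x). lra.
Qed.

Lemma Tn_lft i n x : (i <= n)%nat -> 0 <= x < 1 -> Tn i (lft n x) = lft (n - i) (Tn i x).
Proof.
  revert n x; induction i; intros n x Hi Hx.
  - simpl. now rewrite Nat.sub_0_r.
  - destruct n; [lia|]. rewrite !Tn_shift, T_lft by assumption.
    rewrite IHi; [reflexivity|lia|apply T_range].
Qed.

Lemma Tn_lft_end n x : 0 <= x < 1 -> Tn n (lft n x) = 0.
Proof.
  intros. rewrite Tn_lft by (lia || assumption). rewrite Nat.sub_diag.
  unfold lft; simpl; lra.
Qed.

(** The difference is exactly [T^n x / b^(n-i)], because truncation commutes with [T]. *)
Lemma Tn_lft_close i n x : (i <= n)%nat -> 0 <= x < 1 ->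
  Rabs (Tn i x - Tn i (lft n x)) <= / b ^ (n - i).
Proof.
  intros Hi Hx. rewrite Tn_lft by assumption. unfold lft.
  replace (Tn i x - _) with (Tn (n - i) (Tn i x) * / b ^ (n - i)) by (unfold Rdiv; ring).
  pose proof (Tn_range (n - i) _ (Tn_range i x Hx)). pose proof (inv_pow_pos (n - i)).
  rewrite Rabs_pos_eq by (apply Rmult_le_pos; lra).
  rewrite <- (Rmult_1_l (/ b ^ (n - i))) at 2. apply Rmult_le_compat_r; lra.
Qed.

(* The points p in [0,1) with T^n p = 0 are the left endpoints of the rank-n cylinders
   and stand for the admissible words of length n; the list may contain other points. *)
Fixpoint zero_list (n : nat) : list R :=
  match n with
  | O => [0]
  | S m => flat_map (fun q => map (fun k => (INR k + q) / b) (seq 0 (Z.to_nat (up b))))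
                    (zero_list m)
  end.

Lemma length_zero_list n : length (zero_list n) = (Z.to_nat (up b) ^ n)%nat.
Proof.
  induction n; [reflexivity|]. simpl.
  rewrite (flat_map_constant_length (c := Z.to_nat (up b))).
  - rewrite IHn. lia.
  - intros. now rewrite length_map, length_seq.
Qed.

Lemma zero_list_complete n p : 0 <= p < 1 -> Tn n p = 0 -> In p (zero_list n).
Proof.
  revert p; induction n; intros p Hp H0.
  - simpl in *. auto.
  - rewrite Tn_shift in H0. simpl. apply in_flat_map. exists (T p). split.
    + apply IHn; [apply T_range|exact H0].
    + destruct (T_digit p) as (d & Hd0 & Hd); [lra|].
      apply in_map_iff. exists (Z.to_nat d).
      assert (E : INR (Z.to_nat d) = IZR d) by (rewrite INR_IZR_INZ, Z2Nat.id; auto).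
      split.
      * rewrite E, <- Hd. field; lra.
      * apply in_seq. split; [lia|]. simpl. apply Z2Nat.inj_lt; [exact Hd0| |].
        { apply le_IZR. destruct (archimed b). lra. }
        apply lt_IZR. destruct (archimed b). pose proof (T_range p).
        assert (b * p < b * 1) by (apply Rmult_lt_compat_l; lra). lra.
Qed.

(** * Full cylinders and their concatenation *)

(* q is the left endpoint of a full cylinder of rank n, i.e. T^n maps
   [q, q + b^-n) affinely onto [0,1). *)
Definition full (n : nat) (q : R) : Prop :=
  0 <= q /\ q + / b ^ n <= 1 /\ Tn n q = 0 /\
  forall y i, 0 <= y < 1 -> (i <= n)%nat ->
    Tn i (q + y / b ^ n) = Tn i q + y / b ^ (n - i).

Lemma full_O : full 0 0.
Proof.
  split; [lra|]. split; [simpl; lra|]. split; [reflexivity|].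
  intros y i Hy Hi. replace i with 0%nat by lia. reflexivity.
Qed.

(** The only obstruction to putting a digit in front of a full word is that the cylinder must fit
    below 1: then [T] maps it affinely onto the full cylinder at [q']. *)
Lemma full_cons n q q' (d : Z) :
  b * q = IZR d + q' -> 0 <= q -> q + / b ^ (S n) <= 1 -> full n q' -> full (S n) q.
Proof.
  intros Hq Hq0 Hq1 (F0 & F1 & F2 & F3). pose proof (inv_pow_pos n) as Hp.
  assert (HT : forall y, 0 <= y < 1 -> T (q + y / b ^ S n) = q' + y / b ^ n).
  { intros y Hy. apply (T_char d).
    - rewrite Rmult_plus_distr_l, Hq. simpl. pose proof (pow_b_pos n). field; lra.
    - unfold Rdiv. assert (0 <= y * / b ^ n) by (apply Rmult_le_pos; lra).
      assert (y * / b ^ n < 1 * / b ^ n) by (apply Rmult_lt_compat_r; lra). lra. }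
  assert (HTq : T q = q').
  { specialize (HT 0 ltac:(lra)). unfold Rdiv in HT.
    rewrite !Rmult_0_l, !Rplus_0_r in HT. exact HT. }
  split; [exact Hq0|]. split; [exact Hq1|]. split.
  - rewrite Tn_shift, HTq. exact F2.
  - intros y [|i] Hy Hi; [reflexivity|].
    rewrite !Tn_shift, HT, HTq by assumption. apply F3; [assumption|lia].
Qed.

Lemma full_zero n : full n 0.
Proof.
  induction n; [apply full_O|].
  apply (full_cons n 0 0 0); [lra|lra| |exact IHn].
  pose proof (inv_pow_le1 (S n)); lra.
Qed.

(** The point [q + r / b ^ n] is the word of [q] followed by the word of [r]: [T^n] maps the
    cylinder at [q] affinely onto [0,1), so a copy of the cylinder at [r], scaled by [b^-n], sits
    inside it. Affinity of [T^i] comes from [q] for i up to n and from [r] afterwards. *)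
Lemma full_app n m q r : full n q -> full m r -> full (n + m) (q + r / b ^ n).
Proof.
  intros (A0 & A1 & A2 & A3) (B0 & B1 & B2 & B3).
  pose proof (inv_pow_pos n). pose proof (inv_pow_pos m).
  pose proof (pow_b_pos n). pose proof (pow_b_pos m).
  assert (Hr : 0 <= r < 1) by lra.
  assert (Hry : forall y, 0 <= y < 1 -> 0 <= r + y / b ^ m < 1).
  { intros y Hy. unfold Rdiv. assert (0 <= y * / b ^ m) by (apply Rmult_le_pos; lra).
    assert (y * / b ^ m < 1 * / b ^ m) by (apply Rmult_lt_compat_r; lra). lra. }
  assert (E : forall y, q + r / b ^ n + y / b ^ (n + m) = q + (r + y / b ^ m) / b ^ n).
  { intros y. rewrite pow_add. field. lra. }
  assert (Hn : forall y, 0 <= y < 1 -> Tn n (q + y / b ^ n) = y).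
  { intros y Hy. rewrite A3, A2, Nat.sub_diag by (assumption || lia). simpl. lra. }
  split; [|split; [|split]].
  - assert (0 <= r / b ^ n) by (apply Rmult_le_pos; lra). lra.
  - assert ((r + / b ^ m) * / b ^ n <= 1 * / b ^ n) by (apply Rmult_le_compat_r; lra).
    rewrite pow_add, Rinv_mult. unfold Rdiv. lra.
  - rewrite (Nat.add_comm n m), Tn_add, Hn by assumption. exact B2.
  - intros y i Hy Hi. rewrite E. destruct (Nat.le_gt_cases i n) as [Hin|Hin].
    + rewrite !A3 by (assumption || auto).
      replace (n + m - i)%nat with (n - i + m)%nat by lia. rewrite pow_add.
      pose proof (pow_b_pos (n - i)). field; lra.
    + replace i with ((i - n) + n)%nat by lia. rewrite !Tn_add.
      rewrite !Hn by auto. rewrite B3 by (assumption || lia).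
      replace (n + m - (i - n + n))%nat with (m - (i - n))%nat by lia. reflexivity.
Qed.

(** A closer point on the right would lie in the cylinder of the left one, where [T^n] vanishes only
    at the left endpoint. *)
Lemma full_separated n p q : full n p -> full n q -> p <> q -> / b ^ n <= Rabs (p - q).
Proof.
  assert (W : forall p q, full n p -> full n q -> p < q -> / b ^ n <= q - p).
  { intros p' q' (A0 & A1 & A2 & A3) (B0 & B1 & B2 & B3) Hpq.
    destruct (Rle_lt_dec (/ b ^ n) (q' - p')) as [|Hlt]; [assumption|exfalso].
    pose proof (pow_b_pos n).
    assert (Hy : 0 < (q' - p') * b ^ n < 1).
    { split; [apply Rmult_lt_0_compat; lra|].
      apply Rmult_lt_reg_r with (/ b ^ n); [apply inv_pow_pos|].
      rewrite Rmult_assoc, Rinv_r, Rmult_1_r, Rmult_1_l by lra. exact Hlt. }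
    specialize (A3 ((q' - p') * b ^ n) n ltac:(lra) (le_n n)).
    replace (p' + (q' - p') * b ^ n / b ^ n) with q' in A3 by (field; lra).
    rewrite A2, B2, Nat.sub_diag in A3. simpl in A3. lra. }
  intros Hp Hq Hne. destruct (Rtotal_order p q) as [H|[H|H]].
  - rewrite Rabs_minus_sym, Rabs_pos_eq by lra. now apply W.
  - contradiction.
  - rewrite Rabs_pos_eq by lra. now apply W.
Qed.

(* Lowering the last nonzero digit of an admissible word makes it full. *)
Lemma full_decrement j p : 0 <= p < 1 -> Tn j p <> 0 -> Tn (S j) p = 0 ->
  / b ^ S j <= p /\ full (S j) (p - / b ^ S j) /\
  forall i, (i <= j)%nat -> Tn i (p - / b ^ S j) = Tn i p - / b ^ (S j - i).
Proof.
  revert p; induction j; intros p Hp H1 H2.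
  - simpl in H1, H2. destruct (T_digit p) as (d & Hd0 & Hd); [lra|].
    rewrite H2, Rplus_0_r in Hd.
    assert (1 <= d)%Z.
    { destruct (Z.eq_dec d 0) as [->|]; [|lia].
      exfalso. apply H1. apply Rmult_eq_reg_l with b; lra. }
    assert (Hle : / b ^ 1 <= p).
    { rewrite pow_1. apply Rmult_le_reg_l with b; [lra|]. rewrite Rinv_r by lra.
      rewrite Hd. apply IZR_le; assumption. }
    split; [exact Hle|]. split.
    (* The right endpoint of the lowered cylinder is [p] itself, so it fits below 1. The same holds
       at each digit put in front in the inductive case. *)
    + apply (full_cons 0 _ 0 (d - 1)); [|lra|lra|apply full_O].
      rewrite minus_IZR, Rmult_minus_distr_l, Hd, pow_1, Rinv_r by lra. lra.
    + intros i Hi. replace i with 0%nat by lia. reflexivity.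
  - rewrite Tn_shift in H1, H2. destruct (IHj (T p) (T_range p) H1 H2) as (Hle & Hf & Hs).
    destruct (T_digit p) as (d & Hd0 & Hd); [lra|]. apply IZR_le in Hd0.
    assert (E : b * / b ^ S (S j) = / b ^ S j).
    { simpl. pose proof (pow_b_pos j). field; lra. }
    assert (Hle' : / b ^ S (S j) <= p).
    { apply Rmult_le_reg_l with b; [lra|]. rewrite E. lra. }
    assert (Eq : b * (p - / b ^ S (S j)) = IZR d + (T p - / b ^ S j)).
    { rewrite Rmult_minus_distr_l, Hd, E. lra. }
    split; [exact Hle'|]. split.
    + apply (full_cons (S j) _ (T p - / b ^ S j) d); [exact Eq|lra|lra|exact Hf].
    + intros [|i] Hi; [reflexivity|]. rewrite !Tn_shift.
      rewrite (T_char d _ _ Eq), Hs by (lia || (pose proof (T_range p);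
        pose proof (inv_pow_pos (S j)); lra)).
      reflexivity.
Qed.

Lemma last_nonzero_digit n p : Tn n p = 0 ->
  p = 0 \/ exists j, (j < n)%nat /\ Tn j p <> 0 /\ Tn (S j) p = 0.
Proof.
  induction n; intros H.
  - left; exact H.
  - destruct (Req_dec (Tn n p) 0) as [H0|H0].
    + destruct (IHn H0) as [|(j & Hj & ?)]; [left; assumption|].
      right; exists j; split; [lia|assumption].
    + right; exists n; auto.
Qed.

(** One relation serves two comparisons: points of a common cylinder, with [m = n], and a word with
    its lowered version, with [m] the position of the lowered digit counted from 1. *)
Definition shadow (n m : nat) (x y : R) : Prop :=
  forall i, (i < n)%nat ->
    ((i < m)%nat -> Rabs (Tn i x - Tn i y) <= / b ^ (m - i)) /\
    ((m <= i)%nat -> Tn i x = Tn i y).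

(** The last clause is the multiplicity bound: a given [q] arises only from itself and from the n+1
    points [q + b^-j]. The strict inequality holds since [q + b^-n <= p] after a lowering; for
    [p = 0] it comes from [1 <= n]. *)
Lemma zero_to_full n p : (1 <= n)%nat -> 0 <= p < 1 -> Tn n p = 0 ->
  exists q, full n q /\ q + / b ^ n < 1 /\ (exists m, shadow n m p q) /\
    (p = q \/ exists j, (j <= n)%nat /\ p = q + / b ^ j).
Proof.
  intros Hn Hp H0. destruct (last_nonzero_digit n p H0) as [->|(j & Hj & Hj1 & Hj2)].
  - exists 0. split; [apply full_zero|]. split; [|split; [|left; reflexivity]].
    + rewrite Rplus_0_l. rewrite <- Rinv_1. apply Rinv_lt_contravar.
      { rewrite Rmult_1_l. apply pow_b_pos. }
      apply Rlt_pow_R1; [lra|lia].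
    + exists 0%nat. intros i Hi. split; [lia|reflexivity].
  - destruct (full_decrement j p Hp Hj1 Hj2) as (Hle & Hf & Hs).
    set (q := p - / b ^ S j) in *.
    assert (Hq : forall i, (S j <= i)%nat -> Tn i p = 0 /\ Tn i q = 0).
    { intros i Hi. replace i with ((i - S j) + S j)%nat by lia. rewrite !Tn_add.
      destruct Hf as (_ & _ & Hf & _). rewrite Hj2, Hf, Tn_0. auto. }
    exists q. split; [|split; [|split]].
    (* The lowered word has length [S j]; a full word of zeros pads it to length n without changing
       the point. *)
    + pose proof (full_app _ _ _ _ Hf (full_zero (n - S j))) as Hf'.
      unfold Rdiv in Hf'. rewrite Rmult_0_l, Rplus_0_r in Hf'.
      replace (S j + (n - S j))%nat with n in Hf' by lia. exact Hf'.
    + pose proof (inv_pow_antitone (S j) n ltac:(lia)). unfold q. lra.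
    + exists (S j). intros i Hi. split.
      * intros Hij. unfold q. rewrite Hs by lia.
        replace (_ - _) with (/ b ^ (S j - i)) by lra.
        pose proof (inv_pow_pos (S j - i)). rewrite Rabs_pos_eq; lra.
      * intros Hij. destruct (Hq i Hij) as [-> ->]. reflexivity.
    + right. exists (S j). split; [lia|]. unfold q; lra.
Qed.

(** * Birkhoff sums *)

Variable psi : R -> R.
Hypothesis Hpsi : cont_on_01 psi.

Notation S_ n x := (Birk b psi n x).

Lemma Birk_add n m x : S_ (n + m) x = S_ n x + S_ m (Tn n x).
Proof.
  induction m; [rewrite Nat.add_0_r; simpl; lra|].
  rewrite <- plus_n_Sm. simpl. rewrite IHm, <- Tn_add, (Nat.add_comm m n). lra.
Qed.

Lemma Birk_bound B : bounded_on_01 psi B -> forall n x, 0 <= x < 1 ->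
  Rabs (S_ n x) <= B * INR n.
Proof.
  intros HB n x Hx. induction n.
  - simpl. rewrite Rabs_R0. lra.
  - rewrite S_INR. simpl. eapply Rle_trans; [apply Rabs_triang|].
    pose proof (Tn_range n x Hx). specialize (HB (Tn n x) ltac:(lra)). lra.
Qed.

(** Terms with [m - i] at least [k0] differ by less than [del], terms from time m on agree, and the
    at most [k0] terms in between cost [2 * B] each. Hence [C] is uniform in n and m. *)
Lemma Birk_shadow del : 0 < del -> exists C, 0 <= C /\
  forall n m x y, 0 <= x < 1 -> 0 <= y < 1 -> shadow n m x y ->
    Rabs (S_ n x - S_ n y) <= del * INR n + C.
Proof.
  intros Hdel. destruct (cont_on_01_bounded psi Hpsi) as (B & HB0 & HB).
  destruct (cont_on_01_uniform psi Hpsi del Hdel) as (eta & Heta & Hu).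
  destruct (inv_pow_small eta Heta) as (k0 & Hk0).
  exists (2 * B * INR k0). split.
  { pose proof (pos_INR k0). apply Rmult_le_pos; lra. }
  intros n m x y Hx Hy Hsh.
  (* The truncated difference counts the indices i below n with [m - k0 <= i < m], the only ones
     where the crude bound may be used. *)
  assert (W : Rabs (S_ n x - S_ n y) <= del * INR n + 2 * B * INR (Nat.min n m - (m - k0))).
  { induction n.
    - simpl. rewrite Rminus_0_r, Rabs_R0. lra.
    - assert (Hsh' : shadow n m x y) by (intros i Hi; apply Hsh; lia).
      specialize (IHn Hsh'). destruct (Hsh n (Nat.lt_succ_diag_r n)) as [H1 H2].
      assert (Hx' := Tn_range n x Hx). assert (Hy' := Tn_range n y Hy).
      assert (Hstep : Rabs (S_ (S n) x - S_ (S n) y) <=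
        Rabs (S_ n x - S_ n y) + Rabs (psi (Tn n x) - psi (Tn n y))).
      { simpl. replace (S_ n x + psi (Tn n x) - (S_ n y + psi (Tn n y))) with
          ((S_ n x - S_ n y) + (psi (Tn n x) - psi (Tn n y))) by ring. apply Rabs_triang. }
      assert (Hmono : INR (Nat.min n m - (m - k0)) <= INR (Nat.min (S n) m - (m - k0)))
        by (apply le_INR; lia).
      assert (HBm : 2 * B * INR (Nat.min n m - (m - k0)) <=
                    2 * B * INR (Nat.min (S n) m - (m - k0)))
        by (apply Rmult_le_compat_l; lra).
      rewrite S_INR. destruct (Nat.le_gt_cases m n) as [Hm|Hm].
      + rewrite H2 in Hstep by exact Hm.
        rewrite Rminus_diag, Rabs_R0 in Hstep. lra.
      + destruct (Nat.le_gt_cases k0 (m - n)) as [Hk|Hk].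
        * assert (Rabs (psi (Tn n x) - psi (Tn n y)) < del).
          { apply Hu; [lra|lra|]. eapply Rle_lt_trans; [apply H1; exact Hm|].
            apply Hk0; exact Hk. }
          lra.
        * replace (Nat.min (S n) m - (m - k0))%nat
            with (S (Nat.min n m - (m - k0))) by lia. rewrite S_INR.
          pose proof (HB (Tn n x) ltac:(lra)). pose proof (HB (Tn n y) ltac:(lra)).
          assert (Rabs (psi (Tn n x) - psi (Tn n y)) <= 2 * B) by (split_Rabs; lra).
          lra. }
  eapply Rle_trans; [exact W|]. apply Rplus_le_compat_l.
  apply Rmult_le_compat_l; [lra|]. apply le_INR. lia.
Qed.

Lemma shadow_lft n x : 0 <= x < 1 -> shadow n n x (lft n x).
Proof.
  intros Hx i Hi. split; [|lia]. intros _. apply Tn_lft_close; [lia|exact Hx].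
Qed.

Lemma full_shadow n q x : full n q -> q <= x < q + / b ^ n -> shadow n n x q.
Proof.
  intros (F0 & F1 & F2 & F3) Hx i Hi. split; [|lia]. intros _.
  pose proof (pow_b_pos n).
  assert (Hy : 0 <= (x - q) * b ^ n < 1).
  { split; [apply Rmult_le_pos; lra|].
    apply Rmult_lt_reg_r with (/ b ^ n); [apply inv_pow_pos|].
    rewrite Rmult_assoc, Rinv_r, Rmult_1_r, Rmult_1_l by lra. lra. }
  specialize (F3 _ i Hy ltac:(lia)).
  replace (q + (x - q) * b ^ n / b ^ n) with x in F3 by (field; lra).
  rewrite F3. set (y := (x - q) * b ^ n) in *. pose proof (inv_pow_pos (n - i)).
  replace (Tn i q + y / b ^ (n - i) - Tn i q) with (y * / b ^ (n - i)) by (unfold Rdiv; ring).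
  rewrite Rabs_pos_eq by (apply Rmult_le_pos; lra).
  rewrite <- (Rmult_1_l (/ b ^ (n - i))) at 2. apply Rmult_le_compat_r; lra.
Qed.

Lemma full_Tn n q x : full n q -> q <= x < q + / b ^ n -> Tn n x = (x - q) * b ^ n.
Proof.
  intros (F0 & F1 & F2 & F3) Hx. pose proof (pow_b_pos n).
  assert (Hy : 0 <= (x - q) * b ^ n < 1).
  { split; [apply Rmult_le_pos; lra|].
    apply Rmult_lt_reg_r with (/ b ^ n); [apply inv_pow_pos|].
    rewrite Rmult_assoc, Rinv_r, Rmult_1_r, Rmult_1_l by lra. lra. }
  specialize (F3 _ n Hy (le_n n)).
  replace (q + (x - q) * b ^ n / b ^ n) with x in F3 by (field; lra).
  rewrite F3, F2, Nat.sub_diag. simpl. lra.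
Qed.

Definition decb (P : Prop) : bool := if excluded_middle_informative P then true else false.

Lemma decb_true P : decb P = true <-> P.
Proof. unfold decb. destruct excluded_middle_informative; intuition discriminate. Qed.

(** * Word counts and the upper bound *)

(** The filter discards the surplus points of [zero_list] and [nodup] the repetitions, so the length
    is a true count of admissible words. *)
Definition words (n : nat) (P : R -> Prop) : list R :=
  filter (fun p => decb (0 <= p < 1 /\ Tn n p = 0 /\ P p)) (nodup Req_dec_T (zero_list n)).

Lemma words_In n P p : In p (words n P) <-> 0 <= p < 1 /\ Tn n p = 0 /\ P p.
Proof.
  unfold words. rewrite filter_In, decb_true, nodup_In. split; [tauto|].
  intros H. split; [|exact H]. apply zero_list_complete; tauto.
Qed.

Lemma words_NoDup n P : NoDup (words n P).
Proof. apply NoDup_filter, NoDup_nodup. Qed.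

Lemma words_length_union n (P Q Q' : R -> Prop) : (forall p, P p -> Q p \/ Q' p) ->
  (length (words n P) <= length (words n Q) + length (words n Q'))%nat.
Proof.
  intros H. rewrite <- length_app. apply NoDup_incl_length; [apply words_NoDup|].
  intros p Hp. apply in_app_iff. rewrite !words_In in *. destruct Hp as (H1 & H2 & H3).
  destruct (H p H3); tauto.
Qed.

Lemma words_length_le n P : (length (words n P) <= Z.to_nat (up b) ^ n)%nat.
Proof.
  rewrite <- length_zero_list. apply NoDup_incl_length; [apply words_NoDup|].
  intros p Hp. apply words_In in Hp. apply zero_list_complete; tauto.
Qed.

Lemma Rpower_inv_pow n s : Rpower (/ b ^ n) s = Rpower b (- (s * INR n)).
Proof.
  rewrite <- Rpower_pow by lra. rewrite <- Rpower_Ropp, Rpower_mult. f_equal. ring.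
Qed.

Lemma Rpower_decay c : 0 < c -> forall eta, 0 < eta ->
  exists n0, forall n, (n0 <= n)%nat -> Rpower b (- (c * INR n)) < eta.
Proof.
  intros Hc eta He.
  assert (H1 : 0 < Rpower b (- c) < 1).
  { split; [apply Rpower_pos|]. rewrite <- (Rpower_O b) by lra. apply Rpower_lt; lra. }
  destruct (pow_lt_1_zero (Rpower b (- c))) with (y := eta) as [N HN].
  - rewrite Rabs_pos_eq; lra.
  - exact He.
  - exists N. intros n Hn. specialize (HN n Hn).
    rewrite <- Rpower_pow, Rpower_mult in HN by lra.
    rewrite Rabs_pos_eq in HN by (left; apply Rpower_pos).
    replace (- (c * INR n)) with (- c * INR n) by ring. exact HN.
Qed.

(** Points whose truncations satisfy [Q n] for all n from m on are covered, at any such large rank,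
    by at most [C b^(sg n)] intervals of length [b^-n]. The s-cost is at most [C b^((sg-s) n)],
    which tends to 0, and these sets exhaust [E] as m varies. *)
Lemma Hnull_of_word_count (sg s C : R) (n0 : nat) (Q : nat -> R -> Prop) (E : R -> Prop) :
  sg < s -> 0 < s ->
  (forall n, (n0 <= n)%nat -> INR (length (words n (Q n))) <= C * Rpower b (sg * INR n)) ->
  (forall x, E x -> 0 <= x < 1 /\
     exists n1, forall n, (n1 <= n)%nat -> Q n (lft n x)) ->
  Hnull s E.
Proof.
  intros Hsg Hs Hcount HE.
  apply Hnull_subset with (fun x => exists m, (fun m x => 0 <= x < 1 /\
    forall n, (m <= n)%nat -> Q n (lft n x)) m x).
  { intros x Hx. destruct (HE x Hx) as (H & n1 & H1). exists n1. auto. }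
  apply Hnull_countable_union; [exact Hs|]. intros m eps He.
  (* [C] has no prescribed sign; this is a positive majorant by which [eps] can be divided. *)
  assert (HC : 0 < Rabs C + 1) by (pose proof (Rabs_pos C); lra).
  destruct (Rpower_decay (s - sg) ltac:(lra) (eps / (Rabs C + 1))) as [n2 Hn2].
  { apply Rdiv_lt_0_compat; lra. }
  set (n := Nat.max m (Nat.max n0 n2)).
  exists (words n (Q n)), (/ b ^ n). split; [apply inv_pow_pos|]. split.
  - rewrite Rpower_inv_pow.
    apply Rle_trans with (C * Rpower b (sg * INR n) * Rpower b (- (s * INR n))).
    + apply Rmult_le_compat_r; [left; apply Rpower_pos|]. apply Hcount. lia.
    + rewrite Rmult_assoc, <- Rpower_plus.
      replace (sg * INR n + - (s * INR n)) with (- ((s - sg) * INR n)) by ring.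
      specialize (Hn2 n ltac:(lia)).
      pose proof (Rpower_pos b (- ((s - sg) * INR n))) as Hpos.
      apply Rle_trans with ((Rabs C + 1) * Rpower b (- ((s - sg) * INR n))).
      { apply Rmult_le_compat_r; [lra|]. pose proof (Rle_abs C); lra. }
      apply Rmult_lt_compat_l with (r := Rabs C + 1) in Hn2; [|exact HC].
      replace ((Rabs C + 1) * (eps / (Rabs C + 1))) with eps in Hn2 by (field; lra). lra.
  - intros x (Hx & HQ). exists (lft n x). split.
    + apply words_In. split; [|split; [apply Tn_lft_end; exact Hx|apply HQ; lia]].
      pose proof (lft_bounds n x Hx). lra.
    + pose proof (Tn_lft_close 0 n x ltac:(lia) Hx) as Hc. simpl in Hc.
      rewrite Nat.sub_0_r in Hc. pose proof (lft_bounds n x Hx).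
      rewrite Rabs_pos_eq in Hc by lra. lra.
Qed.

(** There are at most [K^n] words of length n, so every exponent above [ln K / ln b] works. This
    makes the infimum defining the dimension one over a nonempty set. *)
Lemma Hnull_exists (E : R -> Prop) : (forall x, E x -> 0 <= x < 1) ->
  exists s, s > 0 /\ Hnull s E.
Proof.
  intros HE. set (K := INR (Z.to_nat (up b))).
  assert (HK : 1 < K).
  { unfold K. destruct (archimed b). rewrite INR_IZR_INZ, Z2Nat.id; [lra|].
    apply le_IZR. lra. }
  assert (Hlb : 0 < ln b) by (rewrite <- ln_1; apply ln_increasing; lra).
  assert (HlK : 0 < ln K) by (rewrite <- ln_1; apply ln_increasing; lra).
  assert (Hs : 0 < ln K / ln b) by (apply Rdiv_lt_0_compat; assumption).
  exists (ln K / ln b + 1). split; [lra|].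
  apply (Hnull_of_word_count (ln K / ln b) _ 1 0 (fun _ _ => True)); [lra|lra| |].
  - intros n _. rewrite Rmult_1_l.
    replace (Rpower b (ln K / ln b * INR n)) with (K ^ n).
    + unfold K. rewrite <- pow_INR. apply le_INR, words_length_le.
    + rewrite <- Rpower_pow by lra. unfold Rpower. f_equal. field. lra.
  - intros x Hx. split; [apply HE, Hx|]. exists 0%nat. auto.
Qed.

(** * Rich and sparse levels of the Birkhoff averages *)

Definition Birk_in (u v : R) (n : nat) (p : R) : Prop :=
  u * INR n < S_ n p < v * INR n.

Definition rich (sg alpha : R) : Prop :=
  forall del, 0 < del -> forall n0, exists n, (n0 <= n)%nat /\
    Rpower b (sg * INR n) <
      INR (length (words n (Birk_in (alpha - del) (alpha + del) n))).

(** The constant [C] and the threshold [n0] make the notion stable under finite unions of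
    overlapping intervals, as compactness requires. *)
Definition sparse (sg u v : R) : Prop :=
  exists C n0, forall n, (n0 <= n)%nat ->
    INR (length (words n (Birk_in u v n))) <= C * Rpower b (sg * INR n).

Lemma sparse_mono sg u v u' v' : sparse sg u v -> u <= u' -> v' <= v -> sparse sg u' v'.
Proof.
  intros (C & n0 & H) Hu Hv. exists C, n0. intros n Hn.
  eapply Rle_trans; [|apply H; exact Hn]. apply le_INR.
  apply NoDup_incl_length; [apply words_NoDup|].
  intros p. rewrite !words_In. intros (H1 & H2 & H3 & H4). split; [|split]; auto.
  pose proof (pos_INR n). split.
  - eapply Rle_lt_trans; [|exact H3]. apply Rmult_le_compat_r; lra.
  - eapply Rlt_le_trans; [exact H4|]. apply Rmult_le_compat_r; lra.
Qed.

Lemma sparse_union sg u v u' v' :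
  sparse sg u v -> sparse sg u' v' -> u' < v -> sparse sg u v'.
Proof.
  intros (C & n0 & H) (C' & n0' & H') Huv.
  (* The 1 is there because the overlap [u' < v] remains strict after multiplication by n only for
     positive n. *)
  exists (C + C'), (Nat.max 1 (Nat.max n0 n0')). intros n Hn.
  specialize (H n ltac:(lia)). specialize (H' n ltac:(lia)).
  eapply Rle_trans; [apply le_INR, (words_length_union n _ (Birk_in u v n) (Birk_in u' v' n))|].
  - intros p [H1 H2]. unfold Birk_in.
    destruct (Rlt_le_dec (S_ n p) (v * INR n)); [left; lra|right].
    split; [|exact H2]. assert (0 < INR n) by (apply lt_0_INR; lia).
    assert (u' * INR n < v * INR n) by (apply Rmult_lt_compat_r; lra). lra.
  - rewrite plus_INR. lra.
Qed.

(** Compactness as an induction along [u,v]: take the supremum of the t for which a neighbourhood of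
    [u,t] is sparse. Its own sparse neighbourhood would push it further unless v has been
    reached. *)
Lemma rich_or_sparse sg u v : u <= v ->
  (exists alpha, u <= alpha <= v /\ rich sg alpha) \/
  (exists del, 0 < del /\ sparse sg (u - del) (v + del)).
Proof.
  intros Huv. destruct (classic (exists alpha, u <= alpha <= v /\ rich sg alpha)) as [|Hno];
    [left; assumption|right].
  assert (Hloc : forall c, u <= c <= v -> exists del, 0 < del /\ sparse sg (c - del) (c + del)).
  { intros c Hc. apply NNPP. intros Hn. apply Hno. exists c. split; [exact Hc|].
    intros del Hdel n0. apply NNPP. intros Hn2. apply Hn. exists del. split; [exact Hdel|].
    exists 1, n0. intros n Hge. rewrite Rmult_1_l.
    apply Rnot_lt_le. intros Hlt. apply Hn2. exists n; auto. }
  pose (P := fun t => u <= t <= v /\ exists del, 0 < del /\ sparse sg (u - del) (t + del)).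
  assert (HPu : P u).
  { split; [lra|]. destruct (Hloc u) as (d & Hd & Hs); [lra|]. exists d; auto. }
  destruct (completeness P) as (sig & Hub & Hlub).
  { exists v. intros t [Ht _]. lra. }
  { exists u; exact HPu. }
  assert (Hsig : u <= sig <= v).
  { split; [apply Hub, HPu|]. apply Hlub. intros t [Ht _]; lra. }
  destruct (Hloc sig Hsig) as (ds & Hds & Hss).
  assert (Ht : exists t, P t /\ sig - ds < t).
  { apply NNPP. intros Hn. assert (sig <= sig - ds); [|lra]. apply Hlub.
    intros t Ht. apply Rnot_lt_le. intros Hlt. apply Hn. exists t; auto. }
  destruct Ht as (t & (Htv & d & Hd & Hst) & Hts).
  pose proof (sparse_union _ _ _ _ _ Hst Hss ltac:(lra)) as Hu.
  (* A step beyond the supremum, stopped at [v]; since [t'] lies in [P], only [t' = v] is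
     possible. *)
  set (t' := Rmin v (sig + ds / 2)). set (d' := Rmin d (ds / 2)).
  assert (Hd' : 0 < d' /\ d' <= d /\ d' <= ds / 2).
  { unfold d', Rmin. destruct Rle_dec; lra. }
  assert (Ht' : t' <= v /\ t' <= sig + ds / 2 /\ (t' = v \/ t' = sig + ds / 2)).
  { unfold t', Rmin. destruct Rle_dec; lra. }
  assert (HPt' : P t').
  { split; [lra|]. exists d'. split; [lra|]. eapply sparse_mono; [exact Hu|lra|lra]. }
  pose proof (Hub t' HPt'). destruct Ht' as (H1 & H2 & [H3|H3]); [|lra].
  rewrite H3 in HPt'. destruct HPt' as (_ & HPt'). exact HPt'.
Qed.

Lemma birk_avg_bound B : bounded_on_01 psi B -> forall x k, 0 <= x < 1 ->
  - B <= birk_avg b psi x k <= B.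
Proof.
  intros HB x k Hx. unfold birk_avg. pose proof (Birk_bound B HB (S k) x Hx) as H.
  assert (Hk : 0 < INR (S k)) by (apply lt_0_INR; lia).
  assert (E : Birk b psi (S k) x / INR (S k) * INR (S k) = Birk b psi (S k) x) by (field; lra).
  split; (apply Rmult_le_reg_r with (INR (S k)); [exact Hk|]); rewrite E; split_Rabs; lra.
Qed.

(** Otherwise infinitely many averages leave the widened interval and, being bounded, accumulate
    outside [u,v]. *)
Lemma acc_pt_eventually u v x : 0 <= x < 1 ->
  (forall c, acc_pt b psi x c -> u <= c <= v) -> forall del, 0 < del ->
  exists k0, forall k, (k0 <= k)%nat -> u - del < birk_avg b psi x k < v + del.
Proof.
  intros Hx Hacc del Hdel. destruct (cont_on_01_bounded psi Hpsi) as (B & HB0 & HB).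
  apply NNPP. intros Hno.
  assert (Hio : forall N, exists k, (N <= k)%nat /\
     (birk_avg b psi x k <= u - del \/ v + del <= birk_avg b psi x k)).
  { intros N. apply NNPP. intros Hn. apply Hno. exists N. intros k Hk.
    split; apply Rnot_le_lt; intros H; apply Hn; exists k; auto. }
  (* [f] need not be increasing: [N <= f N] already makes accumulation points along [f] accumulation
     points of the averages. *)
  pose (f := fun N => proj1_sig (constructive_indefinite_description _ (Hio N))).
  assert (Hf : forall N, (N <= f N)%nat /\
     (birk_avg b psi x (f N) <= u - del \/ v + del <= birk_avg b psi x (f N))).
  { intros N. exact (proj2_sig (constructive_indefinite_description _ (Hio N))). }
  destruct (Bolzano_Weierstrass (fun N => birk_avg b psi x (f N)) (fun z => - B <= z <= B))
    as [c Hc].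
  - apply compact_P3.
  - intros N. apply birk_avg_bound; assumption.
  - assert (Hc' : forall eps, eps > 0 -> forall N, exists p, (N <= p)%nat /\
       Rabs (birk_avg b psi x (f p) - c) < eps).
    { intros eps He N. destruct (Hc (fun z => Rabs (z - c) < eps) N) as (p & Hp & Hp2).
      - exists (mkposreal eps He). intros z Hz. exact Hz.
      - exists p; auto. }
    assert (Hcc : acc_pt b psi x c).
    { intros eps He N. destruct (Hc' eps He N) as (p & Hp & Hp2).
      exists (f p). split; [|exact Hp2]. destruct (Hf p). lia. }
    specialize (Hacc c Hcc). destruct (Hc' del Hdel 0%nat) as (p & _ & Hp).
    destruct (Hf p) as [_ [H|H]]; split_Rabs; lra.
Qed.

(** The margin [del] is split: [del/2] for the averages of x to approach [u,v], [del/4] for the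
    uniform error of passing to the left endpoint, and [del/4] to absorb the constant [D] at large
    n. *)
Lemma sparse_Hnull sg s u v del : sg < s -> 0 < s -> 0 < del ->
  sparse sg (u - del) (v + del) ->
  Hnull s (fun x => 0 <= x < 1 /\ forall c, acc_pt b psi x c -> u <= c <= v).
Proof.
  intros Hsg Hs Hdel (C & n0 & H).
  apply (Hnull_of_word_count sg s C n0 (Birk_in (u - del) (v + del))); [lra|lra|exact H|].
  intros x (Hx & Hacc). split; [exact Hx|].
  destruct (acc_pt_eventually u v x Hx Hacc (del / 2) ltac:(lra)) as (k0 & Hk0).
  destruct (Birk_shadow (del / 4) ltac:(lra)) as (D & HD0 & HD).
  destruct (INR_unbounded (4 * D / del)) as [n2 Hn2].
  exists (Nat.max (S k0) (S n2)). intros n Hn.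
  destruct n as [|k]; [lia|]. specialize (Hk0 k ltac:(lia)). unfold birk_avg in Hk0.
  pose proof (lft_bounds (S k) x Hx) as Hl.
  specialize (HD (S k) (S k) x (lft (S k) x) Hx ltac:(lra) (shadow_lft _ _ Hx)).
  assert (Hk : 0 < INR (S k)) by (apply lt_0_INR; lia).
  assert (HDk : D < del / 4 * INR (S k)).
  { assert (INR n2 < INR (S k)) by (apply lt_INR; lia).
    assert (Hq : 4 * D / del < INR (S k)) by lra.
    apply Rmult_lt_compat_l with (r := del / 4) in Hq; [|lra].
    replace (del / 4 * (4 * D / del)) with D in Hq by (field; lra). exact Hq. }
  unfold Birk_in.
  assert (E : Birk b psi (S k) x / INR (S k) * INR (S k) = Birk b psi (S k) x) by (field; lra).
  assert (E1 : (u - del / 2) * INR (S k) < Birk b psi (S k) x).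
  { rewrite <- E. apply Rmult_lt_compat_r; lra. }
  assert (E2 : Birk b psi (S k) x < (v + del / 2) * INR (S k)).
  { rewrite <- E. apply Rmult_lt_compat_r; lra. }
  set (X := Birk b psi (S k) x) in *. set (Y := Birk b psi (S k) (lft (S k) x)) in *.
  set (N := INR (S k)) in *.
  assert (- (del / 2 * N) < X - Y < del / 2 * N) by (split_Rabs; lra).
  split; lra.
Qed.

(** * Moran sets and the lower bound *)

(** Absorbs the multiplicity of the lowering. With [h] half the exponential rate, the power is
    [exp(h n)^2 >= (1 + h n)^2], and [h^2 n^2 > 2 n] once [n > 2 / h^2]. *)
Lemma Rpower_dominates c : 0 < c -> exists n0, forall n, (n0 <= n)%nat ->
  INR n + 2 <= Rpower b (c * INR n).
Proof.
  intros Hc. assert (Hlb : 0 < ln b) by (rewrite <- ln_1; apply ln_increasing; lra).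
  set (h := c * ln b / 2).
  assert (Hh : 0 < h) by (unfold h; apply Rdiv_lt_0_compat; [apply Rmult_lt_0_compat|]; lra).
  destruct (INR_unbounded (2 / (h * h))) as [n0 Hn0]. exists (S n0). intros n Hn.
  assert (H1 : 1 <= INR n) by (apply (le_INR 1); lia).
  assert (H2 : 2 / (h * h) < INR n) by (assert (INR n0 <= INR n) by (apply le_INR; lia); lra).
  apply Rmult_lt_compat_l with (r := h * h) in H2; [|apply Rmult_lt_0_compat; lra].
  replace (h * h * (2 / (h * h))) with 2 in H2 by (field; lra).
  replace (Rpower b (c * INR n)) with (exp (h * INR n) * exp (h * INR n)).
  - assert (Hhn : 0 < h * INR n) by (apply Rmult_lt_0_compat; lra).
    pose proof (exp_ineq1 (h * INR n) ltac:(lra)) as He.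
    apply Rle_trans with ((1 + h * INR n) * (1 + h * INR n));
      [|apply Rmult_le_compat; lra].
    assert (2 * INR n < h * h * INR n * INR n) by (apply Rmult_lt_compat_r; lra). lra.
  - rewrite <- exp_plus. unfold Rpower, h. f_equal. field.
Qed.

(** The estimate covers the whole cylinder because in a concatenation the orbit enters it at a point
    fixed by the later blocks. The strict inequality keeps limits of nested cylinders away from
    right endpoints. *)
Definition block (alpha eps : R) (n : nat) (q : R) : Prop :=
  full n q /\ q + / b ^ n < 1 /\
  forall x, q <= x < q + / b ^ n -> Rabs (S_ n x - alpha * INR n) <= eps * INR n.

(** Of [eps], richness uses one half; the lowering and the motion inside the cylinder use a quarter
    each, made of [eps/8] and of [D < eps/8 * n]. The drop from [sg] to [sg'] pays the factor
    n+2. *)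
Lemma rich_blocks sg sg' alpha eps : sg' < sg -> 0 < eps -> rich sg alpha ->
  exists n V, (1 <= n)%nat /\ NoDup V /\ Rpower b (sg' * INR n) <= INR (length V) /\
    forall q, In q V -> block alpha eps n q.
Proof.
  intros Hsg Heps Hrich.
  destruct (Birk_shadow (eps / 8) ltac:(lra)) as (D & HD0 & HD).
  destruct (Rpower_dominates (sg - sg') ltac:(lra)) as [n1 Hn1].
  destruct (INR_unbounded (8 * D / eps)) as [n2 Hn2].
  destruct (Hrich (eps / 2) ltac:(lra) (Nat.max 1 (Nat.max n1 n2))) as (n & Hn & Hcard).
  set (W := words n _) in *.
  pose (P := fun p q => full n q /\ q + / b ^ n < 1 /\ (exists m, shadow n m p q) /\
    (p = q \/ exists j, (j <= n)%nat /\ p = q + / b ^ j)).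
  pose (F := fun p => epsilon (inhabits 0) (P p)).
  assert (HF : forall p, In p W -> P p (F p)).
  { intros p Hp. apply words_In in Hp. destruct Hp as (H1 & H2 & _).
    apply epsilon_spec. apply (zero_to_full n p); [lia|exact H1|exact H2]. }
  exists n, (nodup Req_dec_T (map F W)). split; [lia|]. split; [apply NoDup_nodup|].
  set (V := nodup _ _).
  assert (HVW : forall q, In q V <-> exists p, F p = q /\ In p W).
  { intros q. unfold V. rewrite nodup_In. apply in_map_iff. }
  split.
  - assert (Hlen : (length W <= length V * (n + 2))%nat).
    { rewrite <- (flat_map_constant_length (c := (n + 2)%nat)
        (fun q => q :: map (fun j => q + / b ^ j) (seq 0 (S n))) V).
      - apply NoDup_incl_length; [apply words_NoDup|]. intros p Hp.
        apply in_flat_map. exists (F p). split; [apply HVW; eauto|].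
        destruct (HF p Hp) as (_ & _ & _ & [E|(j & Hj & E)]).
        + left. symmetry; exact E.
        + right. apply in_map_iff. exists j. split; [symmetry; exact E|].
          apply in_seq. lia.
      - intros q _. simpl length. rewrite length_map, length_seq. lia. }
    apply le_INR in Hlen. rewrite mult_INR, plus_INR in Hlen. simpl (INR 2) in Hlen.
    specialize (Hn1 n ltac:(lia)).
    apply Rmult_le_reg_r with (Rpower b ((sg - sg') * INR n)); [apply Rpower_pos|].
    rewrite <- Rpower_plus.
    replace (sg' * INR n + (sg - sg') * INR n) with (sg * INR n) by ring.
    assert (INR (length V) * (INR n + 2) <= INR (length V) * Rpower b ((sg - sg') * INR n)).
    { apply Rmult_le_compat_l; [apply pos_INR|exact Hn1]. }
    lra.
  - intros q Hq. apply HVW in Hq. destruct Hq as (p & <- & Hp).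
    destruct (HF p Hp) as (Hfull & Hlt & (m & Hsh) & _).
    apply words_In in Hp. destruct Hp as (Hp1 & Hp2 & Hp3).
    split; [exact Hfull|]. split; [exact Hlt|]. intros x Hx.
    pose proof Hfull as (F0 & _). pose proof (inv_pow_pos n).
    pose proof (HD n m p (F p) Hp1 ltac:(lra) Hsh) as D1.
    pose proof (HD n n x (F p) ltac:(lra) ltac:(lra) (full_shadow _ _ _ Hfull Hx)) as D2.
    unfold Birk_in in Hp3.
    assert (HDn : D < eps / 8 * INR n).
    { assert (INR n2 <= INR n) by (apply le_INR; lia).
      assert (Hq : 8 * D / eps < INR n) by lra.
      apply Rmult_lt_compat_l with (r := eps / 8) in Hq; [|lra].
      replace (eps / 8 * (8 * D / eps)) with D in Hq by (field; lra). exact Hq. }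
    set (N := INR n) in *. split_Rabs; lra.
Qed.

(** * Trees of concatenated full words and mass distribution *)

Section Moran.

Variable V : nat -> list R.
Variable len : nat -> nat.
Hypothesis Hlen : forall i, (1 <= len i)%nat.
Hypothesis HVnd : forall i, NoDup (V i).
Hypothesis HVfull : forall i q, In q (V i) -> full (len i) q /\ q + / b ^ len i < 1.
Hypothesis HVne : forall i, V i <> [].

Fixpoint L (i : nat) : nat := match i with O => O | S k => (L k + len k)%nat end.

Lemma L_ge i : (i <= L i)%nat.
Proof. induction i; simpl; [lia|]. specialize (Hlen i). lia. Qed.

Lemma L_mono i j : (i <= j)%nat -> (L i <= L j)%nat.
Proof. induction 1; simpl; lia. Qed.

Lemma child_full i u p : full (L i) u -> In p (V i) ->
  full (L (S i)) (u + p / b ^ L i) /\ u <= u + p / b ^ L i /\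
  u + p / b ^ L i + / b ^ L (S i) < u + / b ^ L i.
Proof.
  intros Hu Hp. destruct (HVfull i p Hp) as [Hf Hlt]. split; [|split].
  - apply full_app; assumption.
  - destruct Hf as (H0 & _). pose proof (inv_pow_pos (L i)).
    assert (0 <= p / b ^ L i) by (apply Rmult_le_pos; lra). lra.
  - simpl L. rewrite pow_add, Rinv_mult. pose proof (inv_pow_pos (L i)) as H.
    assert ((p + / b ^ len i) * / b ^ L i < 1 * / b ^ L i) by (apply Rmult_lt_compat_r; lra).
    unfold Rdiv. lra.
Qed.

(* Left endpoints of the cylinders m generations below the node u of generation i. *)
Fixpoint desc (i m : nat) (u : R) : list R :=
  match m with
  | O => [u]
  | S k => flat_map (fun p => desc (S i) k (u + p / b ^ L i)) (V i)
  end.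

Fixpoint tot (i m : nat) : nat :=
  match m with O => 1%nat | S k => (length (V i) * tot (S i) k)%nat end.

Lemma length_desc i m u : length (desc i m u) = tot i m.
Proof.
  revert i u; induction m; intros i u; [reflexivity|]. simpl.
  now rewrite (flat_map_constant_length (c := tot (S i) m)) by auto.
Qed.

Lemma desc_add i m k u : desc i (m + k) u = flat_map (desc (i + m) k) (desc i m u).
Proof.
  revert i u; induction m; intros i u; simpl.
  - now rewrite Nat.add_0_r, app_nil_r.
  - rewrite flat_map_flat_map. apply flat_map_ext. intros p.
    now rewrite IHm, <- plus_n_Sm.
Qed.

Lemma tot_add i m k : tot i (m + k) = (tot i m * tot (i + m) k)%nat.
Proof.
  revert i; induction m; intros i; simpl.
  - now rewrite !Nat.add_0_r.
  - now rewrite IHm, <- plus_n_Sm, Nat.mul_assoc.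
Qed.

Lemma tot_pos i m : (1 <= tot i m)%nat.
Proof.
  revert i; induction m; intros i; simpl; [lia|]. specialize (IHm (S i)).
  pose proof (HVne i). destruct (V i); [contradiction|]. simpl. lia.
Qed.

Lemma desc_full i m u w : full (L i) u -> In w (desc i m u) ->
  full (L (i + m)) w /\ u <= w /\ w + / b ^ L (i + m) <= u + / b ^ L i.
Proof.
  revert i u; induction m; intros i u Hu Hw; simpl in Hw.
  - destruct Hw as [<-|[]]. rewrite Nat.add_0_r. split; [exact Hu|split; apply Rle_refl].
  - apply in_flat_map in Hw. destruct Hw as (p & Hp & Hw).
    destruct (child_full i u p Hu Hp) as (H1 & H2 & H3).
    destruct (IHm _ _ H1 Hw) as (H4 & H5 & H6).
    rewrite <- plus_n_Sm. change (S i + m)%nat with (S (i + m)) in *.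
    split; [exact H4|split; lra].
Qed.

Lemma desc_NoDup i m u : full (L i) u -> NoDup (desc i m u).
Proof.
  revert i u; induction m; intros i u Hu; simpl.
  - constructor; [intros []|constructor].
  - apply NoDup_flat_map_disjoint; [apply HVnd| |].
    + intros p Hp. apply IHm. now apply child_full.
    + intros p p' w Hp Hp' Hne Hw Hw'.
      destruct (child_full i u p Hu Hp) as (H1 & _).
      destruct (child_full i u p' Hu Hp') as (H1' & _).
      destruct (desc_full _ _ _ _ H1 Hw) as (_ & H2 & H3).
      destruct (desc_full _ _ _ _ H1' Hw') as (_ & H2' & H3').
      pose proof (inv_pow_pos (L (S i + m))).
      pose proof (full_separated _ _ _ H1 H1') as Hs.
      assert (Hne' : u + p / b ^ L i <> u + p' / b ^ L i).
      { intros E. apply Hne. pose proof (pow_b_pos (L i)).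
        apply Rmult_eq_reg_r with (/ b ^ L i); [unfold Rdiv in E; lra|].
        pose proof (inv_pow_pos (L i)); lra. }
      specialize (Hs Hne'). split_Rabs; lra.
Qed.

Definition node_in (lo hi : R) (m : nat) (w : R) : bool :=
  decb (lo < w /\ w + / b ^ L m < hi).

(* If the length of the interval lies between those of the cylinders of generations
   i+1 and i, then it meets at most two cylinders of generation i. *)
Lemma node_count t c0 lo hi m : 0 < t -> 0 < c0 -> lo < hi ->
  (forall i, c0 * Rpower b (t * INR (L (S i))) <= INR (tot 0 i)) ->
  INR (length (filter (node_in lo hi m) (desc 0 m 0))) <=
    (1 + 2 / c0) * Rpower (hi - lo) t * INR (tot 0 m).
Proof.
  intros Ht Hc0 Hlohi Hgrow.
  assert (HA : 0 < 2 / c0) by (apply Rdiv_lt_0_compat; lra).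
  pose proof (Rpower_pos (hi - lo) t) as HR.
  destruct (filter (node_in lo hi m) (desc 0 m 0)) as [|w fl] eqn:Efl.
  { simpl. apply Rmult_le_pos; [apply Rmult_le_pos; lra|apply pos_INR]. }
  rewrite <- Efl.
  assert (Hw : In w (filter (node_in lo hi m) (desc 0 m 0))) by (rewrite Efl; left; reflexivity).
  clear fl Efl. apply filter_In in Hw. destruct Hw as [_ Hw]. apply (proj1 (decb_true _)) in Hw.
  destruct (Rle_lt_dec 1 (hi - lo)) as [Hge|Hlt].
  - apply Rle_trans with (INR (tot 0 m)).
    { apply le_INR. rewrite <- (length_desc 0 m 0). apply filter_length_le. }
    assert (1 <= Rpower (hi - lo) t).
    { rewrite <- (Rpower_O (hi - lo)) by lra. apply Rle_Rpower; lra. }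
    assert (1 * 1 <= (1 + 2 / c0) * Rpower (hi - lo) t) by (apply Rmult_le_compat; lra).
    rewrite <- (Rmult_1_l (INR (tot 0 m))) at 1.
    apply Rmult_le_compat_r; [apply pos_INR|lra].
  (* The counted node [w] shows that cylinders of generation m are shorter than the interval, so
     such a generation exists. *)
  - assert (Hi : exists i, (i < m)%nat /\ / b ^ L (S i) <= hi - lo < / b ^ L i).
    { assert (Hm : / b ^ L m <= hi - lo) by lra.
      clear w Hw. induction m.
      - exfalso. simpl in Hm. lra.
      - destruct (Rle_lt_dec (/ b ^ L m) (hi - lo)) as [H|H].
        + destruct (IHm H) as (i & Hi & Hi'). exists i. split; [lia|exact Hi'].
        + exists m. split; [lia|]. split; assumption. }
    destruct Hi as (i & Him & Hi1 & Hi2).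
    assert (H00 : full (L 0) 0) by apply full_O.
    (* An ancestor of a counted node meets the interval, so its left endpoint is in this window,
       whose length is less than two cylinders of generation i. *)
    set (h := fun u => decb (lo - / b ^ L i < u < hi)).
    assert (Hcount : (length (filter (node_in lo hi m) (desc 0 m 0)) <=
        length (filter h (desc 0 i 0)) * tot i (m - i))%nat).
    { replace (desc 0 m 0) with (desc 0 (i + (m - i)) 0) by (f_equal; lia).
      rewrite desc_add. apply length_filter_flat_map_le.
      - intros u Hu. apply length_desc.
      - intros u v Hu Hv Hf. apply (proj1 (decb_true _)) in Hf. apply (proj2 (decb_true _)).
        destruct (desc_full _ _ _ _ H00 Hu) as (Hfu & _). simpl plus in *.
        destruct (desc_full _ _ _ _ Hfu Hv) as (_ & H1 & H2).
        replace (i + (m - i))%nat with m in H2 by lia.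
        pose proof (inv_pow_pos (L m)). lra. }
    assert (Htwo : (length (filter h (desc 0 i 0)) <= 2)%nat).
    { assert (Hnd : NoDup (filter h (desc 0 i 0))) by (apply NoDup_filter, desc_NoDup, H00).
      assert (Hp : forall u, In u (filter h (desc 0 i 0)) ->
                  full (L i) u /\ lo - / b ^ L i < u < hi).
      { intros u Hu. apply filter_In in Hu. destruct Hu as [Hu1 Hu2].
        apply (proj1 (decb_true _)) in Hu2. split; [|exact Hu2].
        apply (desc_full 0 i 0 u H00 Hu1). }
      destruct (filter h (desc 0 i 0)) as [|x [|y [|z k]]]; simpl; try lia. exfalso.
      inversion_clear Hnd as [|? ? N1 N2]. inversion_clear N2 as [|? ? N3 N4].
      destruct (Hp x) as (Fx & Bx); [simpl; auto|].
      destruct (Hp y) as (Fy & By); [simpl; auto|].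
      destruct (Hp z) as (Fz & Bz); [simpl; auto|].
      simpl in N1, N3.
      apply (three_separated (/ b ^ L i) (lo - / b ^ L i) hi x y z); [lra|lra|lra|lra| | |];
        apply full_separated; try assumption; intros ->; tauto. }
    apply Rle_trans with (2 * INR (tot i (m - i))).
    { replace 2 with (INR 2) by (simpl; lra). rewrite <- mult_INR. apply le_INR. nia. }
    replace (tot 0 m) with (tot 0 (i + (m - i))) by (f_equal; lia).
    rewrite tot_add, mult_INR. simpl plus. rewrite <- Rmult_assoc.
    apply Rmult_le_compat_r; [apply pos_INR|].
    (* The interval is at least a cylinder of generation i+1 long, so growth at i bounds [c0] by its
       t-th power times [tot 0 i]; this converts the 2 into a share of all nodes. *)
    assert (H1 : Rpower b (- (t * INR (L (S i)))) <= Rpower (hi - lo) t).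
    { rewrite <- Rpower_inv_pow. apply Rle_Rpower_l; [lra|].
      split; [apply inv_pow_pos|exact Hi1]. }
    assert (H2 : c0 <= Rpower (hi - lo) t * INR (tot 0 i)).
    { apply Rle_trans with (Rpower b (- (t * INR (L (S i)))) *
                            (c0 * Rpower b (t * INR (L (S i))))).
      - rewrite Rmult_comm, Rmult_assoc, <- Rpower_plus, Rplus_opp_r, Rpower_O by lra. lra.
      - apply Rmult_le_compat; [left; apply Rpower_pos| |exact H1|apply Hgrow].
        apply Rmult_le_pos; [lra|left; apply Rpower_pos]. }
    assert (H3 : 2 / c0 * c0 <= (1 + 2 / c0) * (Rpower (hi - lo) t * INR (tot 0 i)))
      by (apply Rmult_le_compat; lra).
    replace (2 / c0 * c0) with 2 in H3 by (field; lra). lra.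
Qed.

Fixpoint path (p : nat -> R) (i : nat) : R :=
  match i with O => 0 | S k => path p k + p k / b ^ L k end.

Lemma path_full p : (forall i, In (p i) (V i)) -> forall i, full (L i) (path p i).
Proof.
  intros Hp i; induction i; [apply full_O|]. now apply (child_full i (path p i) (p i)).
Qed.

Lemma path_nested p : (forall i, In (p i) (V i)) -> forall i k,
  path p i <= path p (k + i) /\ path p (k + i) + / b ^ L (k + i) <= path p i + / b ^ L i.
Proof.
  intros Hp i k; induction k; [simpl; lra|].
  destruct (child_full (k + i) (path p (k + i)) (p (k + i)%nat)
              (path_full p Hp _) (Hp _)) as (_ & H2 & H3).
  change (S k + i)%nat with (S (k + i)). change (path p (S (k + i))) with
    (path p (k + i) + p (k + i)%nat / b ^ L (k + i)). lra.
Qed.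

(* The limit lies strictly below every right endpoint because no block is the
   rightmost one. *)
Lemma path_limit p : (forall i, In (p i) (V i)) ->
  exists x, forall i, path p i <= x < path p i + / b ^ L i.
Proof.
  intros Hp. pose proof (path_nested p Hp) as Hn.
  assert (Hub : forall i, is_upper_bound (fun y => exists j, y = path p j)
                            (path p i + / b ^ L i)).
  { intros i y (j & ->). pose proof (inv_pow_pos (L i)). pose proof (inv_pow_pos (L j)).
    destruct (Nat.le_ge_cases i j).
    - destruct (Hn i (j - i)%nat) as [_ H2]. replace (j - i + i)%nat with j in H2 by lia. lra.
    - destruct (Hn j (i - j)%nat) as [H2 _]. replace (i - j + j)%nat with i in H2 by lia. lra. }
  destruct (completeness (fun y => exists j, y = path p j)) as (x & Hx1 & Hx2).
  - exists (path p 0 + / b ^ L 0). apply Hub.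
  - exists (path p 0). exists 0%nat; reflexivity.
  - exists x. intros i. split; [apply Hx1; exists i; reflexivity|].
    apply Rle_lt_trans with (path p (S i) + / b ^ L (S i)); [apply Hx2, Hub|].
    apply child_full; [apply path_full, Hp|apply Hp].
Qed.

(* Compactness of the Moran set, by following a branch along which no finite subcover
   exists. *)
Lemma finite_subcover (lo hi : nat -> R) :
  (forall p x, (forall i, In (p i) (V i)) ->
     (forall i, path p i <= x < path p i + / b ^ L i) ->
     exists k, lo k < x < hi k) ->
  exists K, forall w, In w (desc 0 K 0) -> exists k, (k <= K)%nat /\
     node_in (lo k) (hi k) K w = true.
Proof.
  intros Hcover.
  (* A single [K] bounds both the depth of the descendants and the indices of the intervals, which
     makes [cov] monotone in [K]. *)
  pose (cov := fun i u K => forall w, In w (desc i K u) -> exists k, (k <= K)%nat /\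
     (lo k < w /\ w + / b ^ L (i + K) < hi k)).
  assert (Hmono : forall i u K K', full (L i) u -> (K <= K')%nat -> cov i u K -> cov i u K').
  { intros i u K K' Hu HK Hc w Hw.
    replace K' with (K + (K' - K))%nat in Hw by lia. rewrite desc_add in Hw.
    apply in_flat_map in Hw. destruct Hw as (v & Hv & Hw).
    destruct (desc_full _ _ _ _ Hu Hv) as (Hfv & _).
    destruct (desc_full _ _ _ _ Hfv Hw) as (_ & H1 & H2).
    replace (i + K + (K' - K))%nat with (i + K')%nat in H2 by lia.
    destruct (Hc v Hv) as (k & Hk & H3 & H4). exists k. split; [lia|]. lra. }
  assert (Hchild : forall i u, full (L i) u ->
    (forall p, In p (V i) -> exists K, cov (S i) (u + p / b ^ L i) K) -> exists K, cov i u K).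
  { intros i u Hu Hc.
    assert (HK : exists K, forall p, In p (V i) -> cov (S i) (u + p / b ^ L i) K).
    { assert (Hsub : forall p, In p (V i) -> full (L (S i)) (u + p / b ^ L i))
        by (intros p Hp; now apply child_full).
      induction (V i) as [|p l IH]; [exists 0%nat; intros p []|].
      destruct IH as [K HK]; [intros; apply Hc; right; assumption|
                              intros; apply Hsub; right; assumption|].
      destruct (Hc p (or_introl eq_refl)) as [K' HK']. exists (Nat.max K K').
      intros q [<-|Hq].
      - apply Hmono with K'; [apply Hsub; left; reflexivity|lia|exact HK'].
      - apply Hmono with K; [apply Hsub; right; exact Hq|lia|apply HK, Hq]. }
    destruct HK as [K HK]. exists (S K). intros w Hw. simpl in Hw.
    apply in_flat_map in Hw. destruct Hw as (p & Hp & Hw).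
    destruct (HK p Hp w Hw) as (k & Hk & H). exists k. split; [lia|].
    rewrite <- plus_n_Sm. exact H. }
  destruct (classic (exists K, cov 0%nat 0 K)) as [[K HK]|Hno].
  { exists K. intros w Hw. destruct (HK w Hw) as (k & Hk & H). exists k. split; [exact Hk|].
    apply (proj2 (decb_true _)). exact H. }
  exfalso.
  pose (nxt := fun i u => epsilon (inhabits 0)
     (fun p => In p (V i) /\ ~ exists K, cov (S i) (u + p / b ^ L i) K)).
  pose (node := fix node i := match i with O => 0 | S k => node k + nxt k (node k) / b ^ L k end).
  pose (p := fun i => nxt i (node i)).
  assert (Enode : forall i, node i = path p i).
  { induction i; [reflexivity|]. simpl. rewrite IHi. unfold p. now rewrite IHi. }
  assert (Hstep : forall i, full (L i) (node i) -> (~ exists K, cov i (node i) K) ->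
     In (p i) (V i) /\ ~ exists K, cov (S i) (node (S i)) K).
  { intros i Hf Hc. apply (epsilon_spec (inhabits 0)
      (fun q => In q (V i) /\ ~ exists K, cov (S i) (node i + q / b ^ L i) K)).
    apply NNPP. intros Hn. apply Hc, Hchild; [exact Hf|]. intros q Hq.
    apply NNPP. intros Hn'. apply Hn. exists q; auto. }
  assert (Hinv : forall i, full (L i) (node i) /\ ~ exists K, cov i (node i) K).
  { induction i; [split; [apply full_O|exact Hno]|]. destruct IHi as [H1 H2].
    destruct (Hstep i H1 H2) as [H3 H4]. split; [|exact H4].
    now apply (child_full i (node i) (p i)). }
  assert (Hp : forall i, In (p i) (V i)) by (intros i; apply Hstep; apply Hinv).
  destruct (path_limit p Hp) as [x Hx].
  destruct (Hcover p x Hp Hx) as (k & Hk1 & Hk2).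
  destruct (inv_pow_small (Rmin (x - lo k) (hi k - x))) as [i Hi].
  { apply Rmin_glb_lt; lra. }
  specialize (Hi (L i) (L_ge i)).
  pose proof (Rmin_l (x - lo k) (hi k - x)). pose proof (Rmin_r (x - lo k) (hi k - x)).
  (* All descendants of this node lie in interval k; depth k is taken because the depth must also
     bound the index. *)
  destruct (Hinv i) as [Hfi Hci]. apply Hci. exists k. intros w Hw. exists k.
  split; [lia|]. destruct (desc_full _ _ _ _ Hfi Hw) as (_ & H1 & H2).
  rewrite Enode in H1, H2. specialize (Hx i). lra.
Qed.

(** Mass distribution by counting: an interval holds at most a fraction [A] times its t-th power of
    the nodes of generation K. Finitely many intervals hold all nodes, yet a total cost of
    [1/(2 A3)] accounts for only half of them. *)
Lemma Moran_not_Hnull (t c0 : R) (E : R -> Prop) : 0 < t -> 0 < c0 ->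
  (forall i, c0 * Rpower b (t * INR (L (S i))) <= INR (tot 0 i)) ->
  (forall p x, (forall i, In (p i) (V i)) ->
     (forall i, path p i <= x < path p i + / b ^ L i) -> E x) ->
  ~ Hnull t E.
Proof.
  intros Ht Hc0 Hgrow HE Hnull.
  set (A := 1 + 2 / c0).
  assert (HA : 0 < A) by (unfold A; pose proof (Rdiv_lt_0_compat 2 c0 ltac:(lra) Hc0); lra).
  set (A3 := A * Rpower 3 t).
  assert (HA3 : 0 < A3) by (apply Rmult_lt_0_compat; [exact HA|apply Rpower_pos]).
  destruct (Hnull (/ (2 * A3))) as (l & r & Hlr & Hcov & Hsum).
  { apply Rinv_0_lt_compat; lra. }
  (* Concentric intervals of triple length contain the closed ones in their interior; this is the
     factor [3^t] in [A3]. *)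
  destruct (finite_subcover (fun k => l k - (r k - l k)) (fun k => r k + (r k - l k)))
    as [K HK].
  { intros p x Hp Hx. destruct (Hcov x (HE p x Hp Hx)) as [k Hk]. exists k.
    specialize (Hlr k). lra. }
  pose proof (length_le_sum_filter
    (fun k => node_in (l k - (r k - l k)) (r k + (r k - l k)) K) K (desc 0 K 0) HK) as H1.
  rewrite length_desc in H1.
  assert (H2 : sum_f_R0 (fun k => INR (length (filter
      (node_in (l k - (r k - l k)) (r k + (r k - l k)) K) (desc 0 K 0)))) K <=
    sum_f_R0 (fun k => Rpower (r k - l k) t * (A3 * INR (tot 0 K))) K).
  { apply sum_Rle. intros k _. specialize (Hlr k).
    eapply Rle_trans; [apply (node_count t c0); [exact Ht|exact Hc0|lra|exact Hgrow]|].
    replace (r k + (r k - l k) - (l k - (r k - l k))) with (3 * (r k - l k)) by ring.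
    rewrite <- Rpower_mult_distr by lra. unfold A3, A. right; ring. }
  rewrite <- scal_sum in H2.
  assert (HT : 0 < INR (tot 0 K)) by (apply lt_0_INR; pose proof (tot_pos 0 K); lia).
  assert (H3 : A3 * INR (tot 0 K) * sum_f_R0 (fun k => Rpower (r k - l k) t) K <=
               A3 * INR (tot 0 K) * / (2 * A3)).
  { apply Rmult_le_compat_l; [apply Rmult_le_pos; lra|apply Hsum]. }
  replace (A3 * INR (tot 0 K) * / (2 * A3)) with (INR (tot 0 K) / 2) in H3 by (field; lra).
  lra.
Qed.

Variable alpha : R.
Variable eps : nat -> R.
Hypothesis HVblock : forall i q, In q (V i) -> block alpha (eps i) (len i) q.
Hypothesis Heps : forall del, 0 < del -> exists i0, forall i, (i0 <= i)%nat -> eps i <= del.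
Hypothesis Hlenlim : forall del, 0 < del -> exists i0, forall i, (i0 <= i)%nat ->
  INR (len i) <= del * INR (L i).

(** The count of generation i is compared with lengths of generation i+1. The lag costs
    [b^(t len i)], at most [b^((sg-t) L i)] from [i0] on; the constant [c0] settles the earlier
    generations. *)
Lemma tot_growth sg t : 0 < t < sg ->
  (forall i, Rpower b (sg * INR (len i)) <= INR (length (V i))) ->
  exists c0, 0 < c0 /\ forall i, c0 * Rpower b (t * INR (L (S i))) <= INR (tot 0 i).
Proof.
  intros Ht Hcard.
  assert (Htot : forall i, Rpower b (sg * INR (L i)) <= INR (tot 0 i)).
  { induction i.
    - simpl. rewrite Rmult_0_r, Rpower_O; lra.
    - replace (S i) with (i + 1)%nat at 2 by lia. rewrite tot_add, mult_INR. simpl.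
      rewrite Nat.mul_1_r, plus_INR, Rmult_plus_distr_l, Rpower_plus.
      apply Rmult_le_compat; [left; apply Rpower_pos|left; apply Rpower_pos|exact IHi|apply Hcard]. }
  destruct (Hlenlim ((sg - t) / t)) as [i0 Hi0]; [apply Rdiv_lt_0_compat; lra|].
  exists (Rpower b (- (t * INR (L (S i0))))). split; [apply Rpower_pos|]. intros i.
  rewrite <- Rpower_plus. destruct (Nat.le_gt_cases i0 i) as [Hi|Hi].
  - eapply Rle_trans; [|apply Htot]. apply Rle_Rpower; [lra|].
    specialize (Hi0 i Hi). apply Rmult_le_compat_l with (r := t) in Hi0; [|lra].
    replace (t * ((sg - t) / t * INR (L i))) with ((sg - t) * INR (L i)) in Hi0 by (field; lra).
    assert (0 <= t * INR (L (S i0))) by (apply Rmult_le_pos; [lra|apply pos_INR]).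
    simpl L at 2. rewrite plus_INR. lra.
  - apply Rle_trans with 1; [|apply (le_INR 1), tot_pos].
    rewrite <- (Rpower_O b) by lra. apply Rle_Rpower; [lra|].
    assert (INR (L (S i)) <= INR (L (S i0))) by (apply le_INR, L_mono; lia).
    assert (t * INR (L (S i)) <= t * INR (L (S i0))) by (apply Rmult_le_compat_l; lra). lra.
Qed.

Lemma L_bracket n : exists i, (L i <= n < L (S i))%nat.
Proof.
  induction n.
  - exists 0%nat. simpl. specialize (Hlen 0%nat). lia.
  - destruct IHn as (i & Hi). destruct (Nat.lt_ge_cases (S n) (L (S i))).
    + exists i. lia.
    + exists (S i). specialize (Hlen (S i)). simpl in *. lia.
Qed.

(** Complete blocks contribute errors [eps i * len i], negligible against the elapsed time, and the
    unfinished last block is itself short compared with [L i]. *)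
Lemma Moran_in_Ealpha p x : (forall i, In (p i) (V i)) ->
  (forall i, path p i <= x < path p i + / b ^ L i) -> Ealpha b psi alpha x.
Proof.
  intros Hp Hx. assert (Hx01 : 0 <= x < 1).
  { specialize (Hx 0%nat). simpl in Hx. lra. }
  split; [exact Hx01|].
  destruct (cont_on_01_bounded psi Hpsi) as (B & HB0 & HB).
  assert (Hstep : forall i, Rabs (S_ (L (S i)) x - alpha * INR (L (S i))) <=
     Rabs (S_ (L i) x - alpha * INR (L i)) + eps i * INR (len i)).
  { intros i. simpl L. rewrite Birk_add, plus_INR.
    destruct (HVblock i (p i) (Hp i)) as (_ & _ & Hblk).
    assert (Hy : p i <= Tn (L i) x < p i + / b ^ len i).
    { rewrite (full_Tn (L i) (path p i)) by (apply path_full, Hp || apply Hx).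
      pose proof (Hx (S i)) as HS. simpl in HS. rewrite pow_add, Rinv_mult in HS.
      pose proof (pow_b_pos (L i)) as Hpos. split.
      - apply Rmult_le_reg_r with (/ b ^ L i); [apply inv_pow_pos|].
        rewrite Rmult_assoc, Rinv_r by lra. unfold Rdiv in HS. lra.
      - apply Rmult_lt_reg_r with (/ b ^ L i); [apply inv_pow_pos|].
        rewrite Rmult_assoc, Rinv_r by lra. unfold Rdiv in HS. lra. }
    specialize (Hblk _ Hy).
    replace (S_ (L i) x + S_ (len i) (Tn (L i) x) - alpha * (INR (L i) + INR (len i)))
      with ((S_ (L i) x - alpha * INR (L i)) +
            (S_ (len i) (Tn (L i) x) - alpha * INR (len i))) by ring.
    eapply Rle_trans; [apply Rabs_triang|]. lra. }
  intros e He. set (B' := B + Rabs alpha).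
  assert (HB' : 0 <= B') by (unfold B'; pose proof (Rabs_pos alpha); lra).
  (* One share of [del] for the complete blocks and [B'] shares for the unfinished one make [e/2];
     the other half absorbs the initial error [e0]. *)
  set (del := e / (2 * (1 + B'))).
  assert (Hdel : 0 < del) by (apply Rdiv_lt_0_compat; lra).
  destruct (Heps del Hdel) as [i1 Hi1]. destruct (Hlenlim del Hdel) as [i2 Hi2].
  set (i0 := Nat.max i1 i2). set (e0 := Rabs (S_ (L i0) x - alpha * INR (L i0))).
  assert (Hsum : forall k, Rabs (S_ (L (k + i0)) x - alpha * INR (L (k + i0))) <=
                           e0 + del * INR (L (k + i0))).
  { induction k.
    - simpl plus. fold e0. assert (0 <= del * INR (L i0))
        by (apply Rmult_le_pos; [lra|apply pos_INR]). lra.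
    - change (S k + i0)%nat with (S (k + i0)).
      eapply Rle_trans; [apply Hstep|]. simpl L. rewrite plus_INR.
      assert (eps (k + i0)%nat * INR (len (k + i0)) <= del * INR (len (k + i0))).
      { apply Rmult_le_compat_r; [apply pos_INR|]. apply Hi1; lia. }
      lra. }
  destruct (INR_unbounded (2 * e0 / e)) as [n1 Hn1].
  exists (Nat.max n1 (L i0)). intros k Hk. unfold Rdist, birk_avg.
  destruct (L_bracket (S k)) as (i & Hi).
  assert (Hii : (i0 <= i)%nat).
  { destruct (Nat.le_gt_cases i0 i) as [|H]; [assumption|].
    pose proof (L_mono (S i) i0 H). lia. }
  pose proof (Hsum (i - i0)%nat) as HLi. replace (i - i0 + i0)%nat with i in HLi by lia.
  specialize (Hi2 i ltac:(lia)).
  assert (Hn : 0 < INR (S k)) by (apply lt_0_INR; lia).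
  assert (HLn : INR (L i) <= INR (S k)) by (apply le_INR; lia).
  assert (Hmain : Rabs (S_ (S k) x - alpha * INR (S k)) <= e0 + del * (1 + B') * INR (S k)).
  { set (r := (S k - L i)%nat). replace (S k) with (L i + r)%nat at 1 2 by (unfold r; lia).
    rewrite Birk_add, plus_INR.
    replace (S_ (L i) x + S_ r (Tn (L i) x) - alpha * (INR (L i) + INR r))
      with ((S_ (L i) x - alpha * INR (L i)) + (S_ r (Tn (L i) x) - alpha * INR r)) by ring.
    eapply Rle_trans; [apply Rabs_triang|].
    assert (H1 : Rabs (S_ r (Tn (L i) x) - alpha * INR r) <= B' * INR r).
    { pose proof (Birk_bound B HB r _ (Tn_range (L i) x Hx01)) as HBr.
      eapply Rle_trans; [apply Rabs_triang|]. rewrite Rabs_Ropp, Rabs_mult.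
      rewrite (Rabs_pos_eq (INR r)) by apply pos_INR. unfold B'. lra. }
    assert (H2 : INR r <= del * INR (L i)).
    { eapply Rle_trans; [|exact Hi2]. apply le_INR. unfold r. simpl in Hi. lia. }
    assert (H3 : B' * INR r <= B' * (del * INR (L i))) by (apply Rmult_le_compat_l; lra).
    assert (H4 : del * (1 + B') * INR (L i) <= del * (1 + B') * INR (S k)).
    { apply Rmult_le_compat_l; [apply Rmult_le_pos; lra|exact HLn]. }
    lra. }
  replace (del * (1 + B')) with (e / 2) in Hmain by (unfold del; field; lra).
  assert (He0 : e0 < e / 2 * INR (S k)).
  { assert (INR n1 <= INR (S k)) by (apply le_INR; lia).
    assert (Hq : 2 * e0 / e < INR (S k)) by lra.
    apply Rmult_lt_compat_l with (r := e / 2) in Hq; [|lra].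
    replace (e / 2 * (2 * e0 / e)) with e0 in Hq by (field; lra). exact Hq. }
  replace (S_ (S k) x / INR (S k) - alpha) with
    ((S_ (S k) x - alpha * INR (S k)) * / INR (S k)) by (field; lra).
  rewrite Rabs_mult, (Rabs_pos_eq (/ INR (S k))) by (left; apply Rinv_0_lt_compat; exact Hn).
  apply Rmult_lt_reg_r with (INR (S k)); [exact Hn|].
  rewrite Rmult_assoc, Rinv_l, Rmult_1_r by lra. lra.
Qed.

End Moran.

(** * Slow passage from block to block *)

Section Schedule.

Variable n : nat -> nat.
Hypothesis Hn : forall k, (1 <= n k)%nat.

(* The state is (k, l): the current block is the k-th one and l is the total length so
   far. We move on to block k+1 once its length is at most l / (k+1). *)
Fixpoint schedule (i : nat) : nat * nat :=
  match i with
  | O => (O, O)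
  | S j => let (k, l) := schedule j in
           (if (S k * n (S k) <=? l + n k)%nat then S k else k, (l + n k)%nat)
  end.

Definition stage (i : nat) : nat := fst (schedule i).

Lemma schedule_snd i : snd (schedule i) = L (fun j => n (stage j)) i.
Proof.
  induction i; [reflexivity|]. simpl. rewrite <- IHi. unfold stage.
  destruct (schedule i); reflexivity.
Qed.

(** The stage changes only when the inequality holds for the new stage, and otherwise the right side
    only grows. It makes block lengths negligible once stages are unbounded. *)
Lemma stage_short i : (stage i * n (stage i) <= L (fun j => n (stage j)) i)%nat.
Proof.
  rewrite <- schedule_snd. unfold stage. induction i; [simpl; lia|].
  cbn [schedule]. destruct (schedule i) as [k l]. cbn [fst snd] in *.
  destruct (Nat.leb_spec (S k * n (S k)) (l + n k)); lia.
Qed.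

Lemma stage_step i : (stage i <= stage (S i))%nat /\
  ((S (stage i) * n (S (stage i)) <= L (fun j => n (stage j)) (S i))%nat ->
   stage (S i) = S (stage i)).
Proof.
  rewrite <- schedule_snd. unfold stage. cbn [schedule].
  destruct (schedule i) as [k l]. cbn [fst snd].
  destruct (Nat.leb_spec (S k * n (S k)) (l + n k)); split; intros; lia.
Qed.

Lemma stage_mono i j : (i <= j)%nat -> (stage i <= stage j)%nat.
Proof. induction 1; [lia|]. pose proof (stage_step m). lia. Qed.

(** Each step adds at least 1 to the total length, so the threshold for leaving stage K is
    eventually passed. *)
Lemma stage_unbounded K : exists i0, forall i, (i0 <= i)%nat -> (K <= stage i)%nat.
Proof.
  induction K.
  - exists 0%nat. lia.
  - destruct IHK as [i0 Hi0]. set (i := (i0 + S K * n (S K))%nat).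
    exists (S i). intros j Hj. apply Nat.le_trans with (stage (S i)); [|now apply stage_mono].
    destruct (stage_step i) as [H1 H2]. pose proof (Hi0 i ltac:(lia)) as HK.
    destruct (Nat.eq_dec (stage i) K) as [E|]; [|lia].
    rewrite E in H2. rewrite H2; [lia|].
    pose proof (L_ge (fun j => n (stage j)) (fun j => Hn _) (S i)). lia.
Qed.

End Schedule.

(** The midpoint [sg'] splits the gap: [sg - sg'] pays for the lowering, [sg' - t] for the lag of
    one generation. Block k has precision [1/(k+1)]. *)
Lemma rich_not_Hnull sg t alpha : 0 < t < sg -> rich sg alpha ->
  ~ Hnull t (Ealpha b psi alpha).
Proof.
  intros Ht Hrich. set (sg' := (t + sg) / 2).
  assert (Hsg' : t < sg' < sg) by (unfold sg'; lra).
  assert (Hinv : forall k, 0 < / (INR k + 1)).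
  { intros k. apply Rinv_0_lt_compat. pose proof (pos_INR k); lra. }
  pose (f := fun k => constructive_indefinite_description _
    (rich_blocks sg sg' alpha _ (proj2 Hsg') (Hinv k) Hrich)).
  pose (g := fun k => constructive_indefinite_description _ (proj2_sig (f k))).
  set (n := fun k => proj1_sig (f k)). set (W := fun k => proj1_sig (g k)).
  assert (HW : forall k, (1 <= n k)%nat /\ NoDup (W k) /\
     Rpower b (sg' * INR (n k)) <= INR (length (W k)) /\
     forall q, In q (W k) -> block alpha (/ (INR k + 1)) (n k) q)
    by (intros k; exact (proj2_sig (g k))).
  clearbody n W. clear f g.
  assert (Hn : forall k, (1 <= n k)%nat) by (intros k; apply HW).
  set (V := fun i => W (stage n i)). set (len := fun i => n (stage n i)).
  assert (Hbig : forall del, 0 < del -> exists i0, forall i, (i0 <= i)%nat ->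
            / (INR (stage n i) + 1) <= del /\ INR (len i) <= del * INR (L len i)).
  { intros del Hdel. destruct (INR_unbounded (/ del)) as [K HK].
    assert (Hid : 0 < / del) by (apply Rinv_0_lt_compat; exact Hdel).
    destruct (stage_unbounded n Hn K) as [i0 Hi0]. exists i0. intros i Hi.
    specialize (Hi0 i Hi). apply le_INR in Hi0. split.
    - rewrite <- (Rinv_inv del). apply Rinv_le_contravar; lra.
    - pose proof (stage_short n i) as Hs. apply le_INR in Hs. rewrite mult_INR in Hs.
      fold len in Hs. unfold len at 1.
      apply Rle_trans with (del * (INR (stage n i) * INR (n (stage n i))));
        [|apply Rmult_le_compat_l; lra].
      rewrite <- Rmult_assoc. rewrite <- (Rmult_1_l (INR (n (stage n i)))) at 1.
      apply Rmult_le_compat_r; [apply pos_INR|].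
      rewrite <- (Rinv_r del) by lra. apply Rmult_le_compat_l; lra. }
  assert (Hne : forall i, V i <> []).
  { intros i E. destruct (HW (stage n i)) as (_ & _ & H & _). unfold V in E.
    rewrite E in H. simpl in H. pose proof (Rpower_pos b (sg' * INR (n (stage n i)))). lra. }
  assert (Hlen : forall i, (1 <= len i)%nat) by (intros i; apply Hn).
  assert (Hfull : forall i q, In q (V i) -> full (len i) q /\ q + / b ^ len i < 1).
  { intros i q Hq. destruct (HW (stage n i)) as (_ & _ & _ & H).
    destruct (H q Hq) as (H1 & H2 & _). auto. }
  assert (Hlim : forall del, 0 < del -> exists i0, forall i, (i0 <= i)%nat ->
            INR (len i) <= del * INR (L len i)).
  { intros del Hdel. destruct (Hbig del Hdel) as [i0 H]. exists i0. apply H. }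
  destruct (tot_growth V len Hne Hlim sg' t) as (c0 & Hc0 & Hgrow);
    [lra|intros i; apply HW|].
  apply (Moran_not_Hnull V len Hlen (fun i => proj1 (proj2 (HW (stage n i)))) Hfull Hne
           t c0); [lra|exact Hc0|exact Hgrow|].
  apply (Moran_in_Ealpha V len Hlen Hfull alpha (fun i => / (INR (stage n i) + 1))).
  - intros i q Hq. now apply HW.
  - intros del Hdel. destruct (Hbig del Hdel) as [i0 H]. exists i0. apply H.
  - exact Hlim.
Qed.

(** * Dimension as an infimum, and the conclusion *)

(** The choice in [dimH] is meaningful only if an infimum exists: the exponents are bounded below by
    0 and nonempty by [Hnull_exists]. It is obtained as a supremum after a change of sign. *)
Lemma dimH_glb (E : R -> Prop) : (forall x, E x -> 0 <= x < 1) ->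
  is_glb (fun s => s > 0 /\ Hnull s E) (dimH E).
Proof.
  intros HE. apply (epsilon_spec (inhabits 0) (is_glb (fun s => s > 0 /\ Hnull s E))).
  destruct (Hnull_exists E HE) as (s0 & Hs0).
  destruct (completeness (fun y => - y > 0 /\ Hnull (- y) E)) as (m & Hm1 & Hm2).
  - exists 0. intros y [Hy _]. lra.
  - exists (- s0). now rewrite Ropp_involutive.
  - exists (- m). split.
    + intros s Hs. specialize (Hm1 (- s)). cbv beta in Hm1.
      rewrite Ropp_involutive in Hm1. specialize (Hm1 Hs). lra.
    + intros m' Hm'. assert (m <= - m'); [|lra]. apply Hm2. intros y Hy.
      specialize (Hm' (- y) Hy). lra.
Qed.

Lemma Ealpha_acc_pt alpha x c : Ealpha b psi alpha x -> acc_pt b psi x c <-> c = alpha.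
Proof.
  intros (_ & Hcv). split.
  - intros Hacc. apply cond_eq. intros e He.
    destruct (Hcv (e / 2)) as [N HN]; [lra|].
    destruct (Hacc (e / 2) ltac:(lra) N) as (k & Hk & Hkc).
    specialize (HN k Hk). unfold Rdist in HN. split_Rabs; lra.
  - intros ->. intros e He N. destruct (Hcv e He) as [N' HN'].
    exists (Nat.max N N'). split; [lia|]. apply HN'. lia.
Qed.

(** If [alpha] were not attained, its level set would be empty and hence null, against
    [rich_not_Hnull]. *)
Lemma hbeta_ge_rich sg alpha : 0 < sg -> rich sg alpha ->
  sg <= hbeta b psi alpha /\ Lpsi b psi alpha.
Proof.
  intros Hsg Hrich. split.
  - apply (dimH_glb (Ealpha b psi alpha)); [intros x [Hx _]; exact Hx|].
    intros t [Ht Hnull]. apply Rnot_lt_le. intros Hlt.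
    apply (rich_not_Hnull sg t alpha); [lra|exact Hrich|exact Hnull].
  - apply NNPP. intros Hno. apply (rich_not_Hnull sg (sg / 2) alpha); [lra|exact Hrich|].
    apply Hnull_empty; [lra|]. intros x Hx. apply Hno. exists x. split; [apply Hx|].
    now apply (Ealpha_acc_pt alpha x alpha Hx).
Qed.

End Dynamics.

Theorem theorem1p1 (beta : R) (psi : R -> R) (a b : R) :
  1 < beta ->
  cont_on_01 psi ->
  a < b ->
  (exists c, a <= c <= b /\ Lpsi beta psi c) ->
  is_lub (fun v => exists alpha, a <= alpha <= b /\ Lpsi beta psi alpha /\
                                 v = hbeta beta psi alpha)
         (dimH (fun x => 0 <= x < 1 /\
                  forall c, acc_pt beta psi x c -> a <= c <= b)).
Proof.
  intros Hbeta Hpsi Hab (c0 & Hc0 & HLc0).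
  set (G := fun x => 0 <= x < 1 /\ forall c, acc_pt beta psi x c -> a <= c <= b).
  destruct (dimH_glb beta Hbeta G) as [HG1 HG2]; [intros x [Hx _]; exact Hx|].
  assert (HE : forall alpha, is_glb (fun s => s > 0 /\ Hnull s (Ealpha beta psi alpha))
                                    (hbeta beta psi alpha)).
  { intros alpha. apply (dimH_glb beta Hbeta). intros x [Hx _]; exact Hx. }
  split.
  - intros v (alpha & Halpha & _ & ->). apply HG2. intros s [Hs Hnull].
    apply (HE alpha). split; [exact Hs|]. apply Hnull_subset with G; [|exact Hnull].
    intros x Hx. split; [apply Hx|]. intros c Hc.
    now rewrite (proj1 (Ealpha_acc_pt _ _ _ _ _ Hx) Hc).
  - intros m Hm.
    (* The level [c0] makes the family nonempty, so the upper bound [m] dominates a dimension and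
       the rates chosen below are positive. *)
    assert (Hm0 : 0 <= m).
    { apply Rle_trans with (hbeta beta psi c0); [|apply Hm; exists c0; auto].
      apply (HE c0). intros s [Hs _]. lra. }
    apply Rnot_lt_le. intros Hlt. set (d := dimH G) in *.
    (* Two exponents strictly between [m] and [d]: richness at the lower one gives a value above
       [m], sparseness makes the set null at the higher one, below [d]. *)
    destruct (rich_or_sparse beta Hbeta psi ((2 * m + d) / 3) a b) as
      [(alpha & Halpha & Hrich)|(del & Hdel & Hsparse)]; [lra| |].
    + destruct (hbeta_ge_rich beta Hbeta psi Hpsi ((2 * m + d) / 3) alpha ltac:(lra) Hrich) as [Hge HL].
      specialize (Hm _ (ex_intro _ alpha (conj Halpha (conj HL eq_refl)))). lra.
    + pose proof (sparse_Hnull beta Hbeta psi Hpsi ((2 * m + d) / 3) ((m + 2 * d) / 3) a b del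
                    ltac:(lra) ltac:(lra) Hdel Hsparse) as Hnull.
      assert (d <= (m + 2 * d) / 3); [|lra]. apply HG1. split; [lra|exact Hnull].
Qed.
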